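(* Let $(G,P,\theta)$ be an algebraic dynamical system such that $G$ is abelian, $P$ is directed, $[G:\theta_p(G)]<\infty$ for all $p\in P$, and the canonical representation $\pi\colon \mathcal{Q}(G\rtimes_\theta P)\to \mathcal{L}(\ell^2(G))$ is faithful. Assume moreover that for all $p,q\in P$ with $p\neq q$ there exists $g\in G$ of infinite order such that the group endomorphism $\Phi_{p,q}$ of $G$ given by $\Phi_{p,q}(h)=\theta_p(h)\theta_q(h^{-1})$ is injective on the subgroup $\langle g\rangle\cong\mathbb{Z}$. If $(G,P,\theta)$ is minimal, that is, $\bigcap_{p\in P}\theta_p(G)=\{1_G\}$, then the $C^*$-algebra $C^*(G)$ is maximal abelian in $\mathcal{Q}(G\rtimes_\theta P)$.
   Context: An algebraic dynamical system is a triple $(G,P,\theta)$ where $G$ is a countable discrete group; $P$ is a right LCM semigroup, i.e. a countable left cancellative monoid in which the intersection of two principal right ideals is either empty or another principal right ideal; and $\theta$ is an action of $P$ on $G$ by injective group endomorphisms $\theta_p$ which respects the order: $pP\cap qP=rP$ implies $\theta_p(G)\cap\theta_q(G)=\theta_r(G)$. $P$ is directed if it is directed with respect to $p\geq q \Leftrightarrow p\in qP$, i.e. $pP\cap qP\neq\emptyset$ for all $p,q\in P$. Write $N_p=[G:\theta_p(G)]$. For directed $P$, the boundary quotient $\mathcal{Q}(G\rtimes_\theta P)$ is the universal $C^*$-algebra generated by a unitary representation $u$ of $G$ and a representation $s$ of the monoid $P$ by isometries satisfying (I) $s_pu_g=u_{\theta_p(g)}s_p$; (II) $s_p^*u_gs_q=u_{g_1}s_{p'}s_{q'}^*u_{g_2}$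 if $g=\theta_p(g_1)\theta_q(g_2)$ and $pP\cap qP=pp'P$, $pp'=qq'$, and $s_p^*u_gs_q=0$ otherwise; (III) $\sum_{[g]\in G/\theta_p(G)}u_gs_ps_p^*u_g^*=1$ whenever $N_p<\infty$. The canonical representation $\pi\colon\mathcal{Q}(G\rtimes_\theta P)\to\mathcal{L}(\ell^2(G))$ is given by $\pi(u_gs_p)\xi_h=\xi_{g\theta_p(h)}$, where $(\xi_h)_{h\in G}$ is the standard orthonormal basis of $\ell^2(G)$. $C^*(G)$ is identified with the $C^*$-subalgebra of $\mathcal{Q}(G\rtimes_\theta P)$ generated by $\{u_g\mid g\in G\}$. *)

(* Defs.v *)
From HB Require Import structures.
From mathcomp Require Import all_boot all_order all_algebra.
From mathcomp Require Import complex ring lra.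
From mathcomp Require Import all_classical all_reals all_analysis.
From mathcomp.analysis.showcase Require summability.

Set Implicit Arguments.
Unset Strict Implicit.
Unset Printing Implicit Defensive.

Import Order.TTheory GRing.Theory Num.Theory.
Import ComplexField.Normc.
Import numFieldNormedType.Exports.

Local Open Scope classical_set_scope.
Local Open Scope ring_scope.

(* Unital C*-algebras, the zero algebra included. The multiplication is a field
   of the mixin because Hierarchy Builder refuses a structure that joins normed
   modules and rings without being declared before [Num.NumDomain]. The ring
   structure is recovered by the instance that follows. *)
HB.mixin Record isCStarAlgebra (C : numClosedFieldType) A
    of CompleteNormedModule C A := {
  cstar_one : A;
  cstar_mul : A -> A -> A;
  star : A -> A;
  cstar_mulA : associative cstar_mul;
  cstar_mul1l : left_id cstar_one cstar_mul;
  cstar_mul1r : right_id cstar_one cstar_mul;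
  cstar_mulDl : left_distributive cstar_mul +%R;
  cstar_mulDr : right_distributive cstar_mul +%R;
  cstar_scaleAl : forall (c : C) x y, c *: cstar_mul x y = cstar_mul (c *: x) y;
  cstar_scaleAr : forall (c : C) x y, c *: cstar_mul x y = cstar_mul x (c *: y);
  starK : involutive star;
  starD : {morph star : x y / x + y};
  starZ : forall (c : C) x, star (c *: x) = c^* *: star x;
  starM : forall x y, star (cstar_mul x y) = cstar_mul (star y) (star x);
  cstar_normM : forall x y, `|cstar_mul x y| <= `|x| * `|y|;
  cstar_normE : forall x, `|cstar_mul (star x) x| = `|x| ^+ 2 }.

#[short(type="cstarAlgType")]
HB.structure Definition CStarAlgebra (C : numClosedFieldType) :=
  {A of isCStarAlgebra C A & CompleteNormedModule C A}.

HB.instance Definition _ (C : numClosedFieldType) (A : cstarAlgType C) :=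
  GRing.Zmodule_isPzRing.Build (CStarAlgebra.sort A) (@cstar_mulA C A)
    (@cstar_mul1l C A) (@cstar_mul1r C A) (@cstar_mulDl C A) (@cstar_mulDr C A).

Section CStarSubalgebras.
Variables (C : numClosedFieldType) (A : cstarAlgType C).
Implicit Types D E : set A.

Record cstar_subalgebra D : Prop := {
  csub0 : D 0;
  csubD : forall x y, D x -> D y -> D (x + y);
  csubZ : forall (c : C) x, D x -> D (c *: x);
  csubM : forall x y, D x -> D y -> D (x * y);
  csub_star : forall x, D x -> D (star x);
  csub_closed : closed D }.

Definition cstar_generated (S : set A) : set A := smallest cstar_subalgebra S.

Definition abelian_cstar_subalgebra D : Prop :=
  cstar_subalgebra D /\ forall x y, D x -> D y -> x * y = y * x.

Definition maximal_abelian D : Prop :=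
  abelian_cstar_subalgebra D /\
  forall E, abelian_cstar_subalgebra E -> D `<=` E -> E = D.

End CStarSubalgebras.

Section AlgebraicDynamicalSystems.
Variables (G : groupType) (P : monoidType).
Implicit Types (theta : P -> G -> G) (p q r : P).
Local Open Scope group_scope.

Definition right_ideal p : set P := [set p * x | x in [set: P]].

Record right_LCM_semigroup : Prop := {
  rlcm_countable : countable [set: P];
  rlcm_cancel : forall p q r, p * q = p * r -> q = r;
  rlcm_ideal : forall p q, right_ideal p `&` right_ideal q = set0 \/
    exists r, right_ideal p `&` right_ideal q = right_ideal r }.

Record algebraic_dynamical_system theta : Prop := {
  ads_countable : countable [set: G];
  ads_rlcm : right_LCM_semigroup;
  ads_morph : forall p, {morph theta p : g h / g * h};
  ads_inj : forall p, injective (theta p);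
  ads_id : forall g, theta 1 g = g;
  ads_comp : forall p q g, theta (p * q) g = theta p (theta q g);
  ads_order : forall p q r, right_ideal p `&` right_ideal q = right_ideal r ->
    range (theta p) `&` range (theta q) = range (theta r) }.

Definition directed : Prop :=
  forall p q, right_ideal p `&` right_ideal q !=set0.

Definition left_cosets theta p : set (set G) :=
  [set [set g * h | h in range (theta p)] | g in [set: G]].

Definition finite_index theta p : Prop := finite_set (left_cosets theta p).

Definition minimal theta : Prop :=
  \bigcap_(p in [set: P]) range (theta p) = [set 1].

Definition Phi theta p q (h : G) : G := theta p h * theta q (h^-1).

Definition infinite_order (g : G) : Prop := forall n, (0 < n)%N -> g ^+ n <> 1.

Definition cyclic_subgroup (g : G) : set G :=
  [set h | exists n, h = g ^+ n \/ h = g ^- n].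

End AlgebraicDynamicalSystems.

Section BoundaryQuotient.
Variables (C : numClosedFieldType) (G : groupType) (P : monoidType).
Variable theta : P -> G -> G.

(* The data of a nonzero summand in (II):
   g = theta_p(g1) theta_q(g2), pP `&` qP = pp'P and pp' = qq'. *)
Definition bq_factorization (p q : P) (g : G) (g1 g2 : G) (p' q' : P) : Prop :=
  [/\ g = (theta p g1 * theta q g2)%g,
      right_ideal p `&` right_ideal q = right_ideal (p * p')%g &
      (p * p')%g = (q * q')%g].

Section Relations.
Variables (A : cstarAlgType C) (u : G -> A) (s : P -> A).

(* In [bq_sum] the representative of a coset is arbitrary: by [bq_I] the summand
   depends only on the coset. *)
Record bq_relations : Prop := {
  bq_u1 : u 1%g = 1;
  bq_uM : forall g h, u (g * h)%g = u g * u h;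
  bq_uV : forall g, star (u g) * u g = 1 /\ u g * star (u g) = 1;
  bq_s1 : s 1%g = 1;
  bq_sM : forall p q, s (p * q)%g = s p * s q;
  bq_isometry : forall p, star (s p) * s p = 1;
  bq_I : forall p g, s p * u g = u (theta p g) * s p;
  bq_II : forall p q g g1 g2 p' q', bq_factorization p q g g1 g2 p' q' ->
    star (s p) * u g * s q = u g1 * s p' * star (s q') * u g2;
  bq_II0 : forall p q g,
    ~ (exists g1 g2 p' q', bq_factorization p q g g1 g2 p' q') ->
    star (s p) * u g * s q = 0;
  bq_sum : forall p, finite_index theta p ->
    \sum_(K \in left_cosets theta p)
      (u (xget 1%g K) * s p * star (s p) * star (u (xget 1%g K))) = 1 }.

End Relations.

(* The universal C*-algebra is only defined up to isomorphism: [boundary_quotient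
   u s] says that [A], with the families [u] and [s], is one. *)
Record boundary_quotient (A : cstarAlgType C) (u : G -> A) (s : P -> A) : Prop := {
  bq_rel : bq_relations u s;
  bq_generated : cstar_generated (range u `|` range s) = [set: A];
  bq_universal : forall (B : cstarAlgType C) (v : G -> B) (t : P -> B),
    bq_relations v t -> exists f : {linear A -> B},
      [/\ f 1 = 1,
          forall x y : A, f (x * y) = f x * f y,
          forall x, f (star x) = star (f x),
          forall g, f (u g) = v g & forall p, f (s p) = t p] }.

End BoundaryQuotient.

Section Ell2.
Variables (R : realType) (G : choiceType).
Implicit Types f g : G -> R[i].

Definition ell2_sqnorm f : \bar R :=
  (\esum_(h in [set: G]) (normc (f h) ^+ 2)%:E)%E.

Definition square_summable : {pred G -> R[i]} :=
  fun f => (ell2_sqnorm f < +oo)%E.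

Lemma square_summable_submod : submod_closed square_summable.
Proof.
have sq_ge0 (f : G -> R[i]) h : (0 <= (normc (f h) ^+ 2)%:E)%E.
  by rewrite lee_fin sqr_ge0.
have nge0 (z : R[i]) : 0 <= normc z by case: z => x y; exact: sqrtr_ge0.
split=> [|a f g]; rewrite !unfold_in /square_summable /ell2_sqnorm.
  by rewrite esum1 ?ltry// => h _; rewrite [normc _]normc0 expr0n.
move=> sf sg; set k : R := 2 * normc a ^+ 2.
have fin (f' : G -> R[i]) :
    (\esum_(h in [set: G]) (normc (f' h) ^+ 2)%:E < +oo)%E ->
    forall c : R, 0 <= c ->
    (\esum_(h in [set: G]) (c * normc (f' h) ^+ 2)%:E < +oo)%E.
  move=> sf' c c0.
  set S := (\esum_(h in [set: G]) (normc (f' h) ^+ 2)%:E)%E in sf' *.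
  apply: (@le_lt_trans _ _ (c%:E * S)%E).
    apply: ge_ereal_sup => _ [F [finF _] <-].
    rewrite (eq_fsbigr (fun h => c%:E * (normc (f' h) ^+ 2)%:E)%E); last first.
      by move=> h _; rewrite EFinM.
    rewrite -ge0_mule_fsumr//; apply: lee_wpmul2l; first by rewrite lee_fin.
    by rewrite -esum_fset//; apply: esum_ge; exists F => //; rewrite esum_fset.
  have S0 : (0 <= S)%E by apply: esum_ge0.
  by rewrite -ge0_fin_numE ?mule_ge0 ?lee_fin// fin_numM// ge0_fin_numE.
apply: (@le_lt_trans _ _
  (\esum_(h in [set: G]) ((k * normc (f h) ^+ 2)%:E +
                          (2 * normc (g h) ^+ 2)%:E))%E).
  apply: le_esum => h _; rewrite -EFinD lee_fin.
  apply: (@le_trans _ _ ((normc (a * f h) + normc (g h)) ^+ 2)).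
    by rewrite lerXn2r ?nnegrE ?addr_ge0 ?nge0 ?le_normcD.
  rewrite normcM /k; have := sqr_ge0 (normc a * normc (f h) - normc (g h)).
  by nra.
rewrite esumD ?lte_add_pinfty ?fin ?mulr_ge0 ?sqr_ge0// => h _.
  by rewrite lee_fin !mulr_ge0 ?sqr_ge0.
by rewrite lee_fin !mulr_ge0 ?sqr_ge0.
Qed.

HB.instance Definition _ :=
  GRing.isSubmodClosed.Build R[i] (G -> R[i]) square_summable
    square_summable_submod.

Record ell2 := Ell2 { ell2_val :> G -> R[i]; _ : square_summable ell2_val }.

HB.instance Definition _ := [isSub for ell2_val].
HB.instance Definition _ := [Choice of ell2 by <:].
HB.instance Definition _ := [SubChoice_isSubLmodule of ell2 by <:].

Definition ell2_norm (x : ell2) : R := Num.sqrt (fine (ell2_sqnorm x)).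

(* Linear in the first variable; [sum] is the limit of the finite partial sums. *)
Definition ell2_inner (x y : ell2) : R[i] :=
  summability.sum (fun h => x h * (y h)^* : R[i]^o).

Definition delta_fun (h k : G) : R[i] := (k == h)%:R.

Lemma delta_fun_summable h : square_summable (delta_fun h).
Proof.
rewrite /square_summable /ell2_sqnorm (esumID [set h]); last first.
  by move=> k _; rewrite lee_fin sqr_ge0.
rewrite [X in (_ + X)%E]esum1 ?adde0 ?setTI.
  rewrite esum_set1 ?ltry//; first by rewrite lee_fin sqr_ge0.
move=> k kh; have {}kh : (k == h) = false by apply/eqP.
by rewrite /delta_fun kh [normc _]normc0 expr0n.
Qed.

Definition xi (h : G) : ell2 := Ell2 (delta_fun_summable h).

Definition bounded_operator (T : ell2 -> ell2) : Prop :=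
  linear T /\ exists M : R, forall x, ell2_norm (T x) <= M * ell2_norm x.

(* A unital *-homomorphism from [A] to the bounded operators on l^2(G). *)
Record ell2_representation (A : cstarAlgType R[i]) (rho : A -> ell2 -> ell2) :
    Prop := {
  rep_bounded : forall a, bounded_operator (rho a);
  rep_linear : forall (c : R[i]) a b x,
    rho (c *: a + b) x = c *: rho a x + rho b x;
  rep_one : forall x, rho 1 x = x;
  rep_mul : forall a b x, rho (a * b) x = rho a (rho b x);
  rep_star : forall a x y,
    ell2_inner (rho a x) y = ell2_inner x (rho (star a) y) }.

End Ell2.

Definition canonical_representation (R : realType) (G : groupType)
    (P : monoidType) (theta : P -> G -> G) (A : cstarAlgType R[i])
    (u : G -> A) (s : P -> A) (rho : A -> ell2 R G -> ell2 R G) : Prop :=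
  ell2_representation rho /\
  forall g p h, rho (u g * s p) (xi R h) = xi R (g * theta p h)%g.

(* Main.v *)
Require Import Defs.
From HB Require Import structures.
From mathcomp Require Import all_boot all_order all_algebra.
From mathcomp Require Import complex ring lra.
From mathcomp Require Import finmap.
From mathcomp Require Import all_classical all_reals all_analysis.

(** Let [phi] be the vector state [x |-> <rho x xi_1, xi_1>]. An element [x] of
    the commutant of the [u_g] has to be approximated in norm by elements of
    [C^*(G)]. Combinations [y] of monomials [u_g s_p s_q^* u_h] are dense, and
    one averages such a [y] close to [x] over conjugation by finitely many
    [u_a]; this fixes [x] and does not increase [|x - y|].

    If [p = q], averaging over representatives of the cosets of [theta_p(G)]
    turns the monomial into [u_gh] divided by the index, by relation (III)
    ([averages_to_diagonal]). If [p <> q], conjugation by [u_a] with [a =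
    theta_q(b)] replaces [g] by [g * Phi_{p,q}(b^-1)] ([monomial_conj]); with
    [b] running through the first [N] powers of an element as in the hypothesis
    on [Phi], the matrix coefficients of the average are bounded by [1 / N]
    ([averages_to_offdiagonal]). As [G] is abelian the averages commute, and
    they can be combined for all the monomials of [y]. So the averages of [y]
    converge to some [c] in [C^*(G)] at the level of matrix coefficients, and
    it follows that [|phi (b^* (x - c) b')| <= |x - y| * |b|_phi * |b'|_phi]
    for [b] and [b'] in the group algebra, then for all [b] and [b'] since the
    vector [xi_1] is cyclic for the [u_g] ([phi_bound_extend]).

    It remains to deduce [|x - c| <= |x - y|], which is where faithfulness
    enters: an injective representation is isometric ([nrm_le_bound]). This is
    proved without spectral theory. Square roots of [1 - h], for self-adjoint
    contractions [h], come from the iteration [b := (h + b^2) / 2]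
    ([cstar_sqrt]); they give absolute values ([cstar_abs]), thereby positive
    parts of self-adjoint elements, and these are the only functions of an
    operator that the usual argument requires. The square roots also give the
    contractivity [|z x|_phi <= |z| * |x|_phi] ([nphi_mul]). *)

Set Implicit Arguments.
Unset Strict Implicit.
Unset Printing Implicit Defensive.

Import Order.TTheory GRing.Theory Num.Theory.
Import ComplexField.Normc.
Import numFieldNormedType.Exports.

Local Open Scope classical_set_scope.
Local Open Scope ring_scope.

(** * Norms and topology of a C*-algebra in real terms *)

Section RealNorm.
Variables (R : realType) (A : cstarAlgType R[i]).
Implicit Types (x y z : A) (c : R[i]) (r : R).

(** The norm of the algebra takes its values in [R[i]]; estimates are carried
    out in the ordered field [R]. *)
Definition nrm x : R := complex.Re `|x|.

Lemma nrmE x : `|x| = (nrm x)%:C%C.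
Proof. by rewrite /nrm RRe_real// ger0_real. Qed.

Lemma nrm_ge0 x : 0 <= nrm x.
Proof. by rewrite -ler0c -nrmE. Qed.

Lemma nrmD x y : nrm (x + y) <= nrm x + nrm y.
Proof. by rewrite -lecR rmorphD/= -!nrmE ler_normD. Qed.

Lemma nrmN x : nrm (- x) = nrm x.
Proof. by rewrite /nrm normrN. Qed.

Lemma nrmB x y : nrm (x - y) = nrm (y - x).
Proof. by rewrite -nrmN opprB. Qed.

Lemma nrm0 : nrm 0 = 0.
Proof. by rewrite /nrm normr0. Qed.

Lemma nrm0_eq0 x : nrm x = 0 -> x = 0.
Proof. by move=> x0; apply: normr0_eq0; rewrite nrmE x0. Qed.

Lemma nrmM x y : nrm (x * y) <= nrm x * nrm y.
Proof. by rewrite -lecR rmorphM/= -!nrmE; exact: cstar_normM. Qed.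

Lemma nrmZ c x : nrm (c *: x) = normc c * nrm x.
Proof.
by apply: complexI; rewrite rmorphM/= -!nrmE normrZ.
Qed.

Lemma nrm_cstar x : nrm (star x * x) = nrm x ^+ 2.
Proof.
by apply: complexI; rewrite rmorphXn/= -!nrmE; exact: cstar_normE.
Qed.

Lemma normcR r : normc (r%:C%C) = `|r|.
Proof. by rewrite /= expr0n addr0 sqrtr_sqr. Qed.

Lemma normc_ge0 c : 0 <= normc c.
Proof. by case: c => p q; exact: sqrtr_ge0. Qed.

Lemma normc_conj c : normc c^* = normc c.
Proof. by apply: complexI; have := norm_conjC c. Qed.

Lemma scalemulAl c x y : (c *: x) * y = c *: (x * y).
Proof. by rewrite cstar_scaleAl. Qed.

Lemma scalemulAr c x y : x * (c *: y) = c *: (x * y).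
Proof. by rewrite cstar_scaleAr. Qed.

(** [starM] for the product of the ring structure, so that it rewrites in
    products written with [*]. *)
Lemma starMr x y : star (x * y) = star y * star x.
Proof. exact: starM. Qed.


Lemma star0 : star (0 : A) = 0.
Proof. by apply: (addrI (star (0:A))); rewrite -starD !addr0. Qed.

Lemma starN x : star (- x) = - star x.
Proof. by apply: (addrI (star x)); rewrite -starD !subrr star0. Qed.

Lemma star1 : star (1 : A) = 1.
Proof.
have h (x : A) : star (1 : A) * x = x.
  by rewrite -[LHS]starK starMr starK mulr1 starK.
by rewrite -[LHS]mulr1.
Qed.

Lemma nrm_star x : nrm (star x) = nrm x.
Proof.
have le y : nrm y <= nrm (star y).
  have [->|y0] := eqVneq (nrm y) 0; first exact: nrm_ge0.
  have yp : 0 < nrm y by rewrite lt_def y0 nrm_ge0.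
  by rewrite -(ler_pM2r yp) -expr2 -nrm_cstar nrmM.
by apply/eqP; rewrite eq_le le -{2}[x]starK le.
Qed.

Lemma starZr r x : star (r%:C%C *: x) = r%:C%C *: star x.
Proof.
rewrite starZ; congr (_ *: _).
by apply/CrealP; rewrite complex_real.
Qed.

Lemma nrm1 : nrm (1 : A) <= 1.
Proof.
have := nrm_cstar 1; rewrite star1 mulr1 => h.
have := nrm_ge0 1; nra.
Qed.

Lemma closed_nrmP (D : set A) : closed D <->
  forall x, (forall e : R, 0 < e -> exists2 y, D y & nrm (x - y) < e) -> D x.
Proof.
split=> cD x Dx; apply: cD; [move=> U /nbhs_normP[/= e e0 eU]|move=> e e0].
  move: e0; rewrite ltcE/= => /andP[/eqP e1 e0].
  have [y Dy xy] := Dx _ e0; exists y; split=> //; apply: eU => /=.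
  by rewrite nrmE ltcE/= e1 eqxx.
have [y [Dy /= xy]] := Dx _ (nbhs_ball_norm x (PosNum (etrans (ltcR 0 e) e0))).
by exists y => //; rewrite -ltcR -nrmE.
Qed.

Lemma nrm_complete (b : nat -> A) :
  (forall e : R, 0 < e ->
    exists N, forall n, (N <= n)%N -> nrm (b N - b n) < e) ->
  exists l, forall e : R, 0 < e ->
    exists N, forall n, (N <= n)%N -> nrm (l - b n) < e.
Proof.
move=> cb; have /cauchy_cvg/cvg_ex[l bl] : cauchy (b @ \oo).
  apply: cauchy_exP => e; rewrite ltcE/= => /andP[/eqP e1 e0].
  have [N NP] := cb _ e0; exists (b N); exists N => // n /= Nn.
  by rewrite -ball_normE /= nrmE ltcE/= -e1 eqxx/= NP.
exists l => e e0.
have /cvgrPdist_lt/(_ e%:C%C) := bl.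
rewrite ltcR => /(_ e0)[N _ NP]; exists N => n /NP.
by rewrite nrmE ltcR.
Qed.

End RealNorm.

(** * Square roots and absolute values *)

Section SquareRoots.
Variables (R : realType) (A : cstarAlgType R[i]).
Implicit Types (h x y z b : A) (r : R).

Local Notation half := ((2^-1 : R)%:C%C).

(** Iteration for a square root of [1 - h]: a fixed point [b] of [b = (h + b^2)
    / 2] satisfies [(1 - b)^2 = 1 - h]. No power series is needed, because the
    iterates are polynomials in [h] with nonnegative coefficients: they and
    their increments are dominated by the same iteration at [h = 1]. *)
Fixpoint visser h n : A :=
  if n is n'.+1 then half *: (h + visser h n' * visser h n') else 0.

Fixpoint visser_bound n : R :=
  if n is n'.+1 then 2^-1 * (1 + visser_bound n' * visser_bound n') else 0.

Lemma visser_bound_itv n : 0 <= visser_bound n <= 1.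
Proof. by elim: n => [|n /andP[IH0 IH1]] /=; apply/andP; split; nra. Qed.

Lemma visser_bound_le : nondecreasing_seq visser_bound.
Proof.
apply/nondecreasing_seqP; elim=> [|k IH].
  by rewrite /= !mulr0 !addr0 mulr1 invr_ge0.
have /andP[k0 _] := visser_bound_itv k.
by rewrite /= ler_pM2l ?invr_gt0// lerD2l ler_pM.
Qed.

Lemma visser_comm h x n : x * h = h * x -> x * visser h n = visser h n * x.
Proof.
move=> xh; elim: n => [|n IH] /=; first by rewrite mulr0 mul0r.
by rewrite scalemulAr scalemulAl mulrDr mulrDl xh mulrA IH -!mulrA IH.
Qed.

Lemma visser_star h n : star h = h -> star (visser h n) = visser h n.
Proof.
move=> hh; elim: n => [|n IH] /=; first exact: star0.
by rewrite starZr starD starMr IH hh.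
Qed.

Lemma visser_nrm h n : nrm h <= 1 -> nrm (visser h n) <= visser_bound n.
Proof.
move=> h1; elim: n => [|n IH] /=; first by rewrite nrm0.
rewrite nrmZ normcR ger0_norm ?invr_ge0// ler_pM2l ?invr_gt0//.
rewrite (le_trans (nrmD _ _))// lerD// (le_trans (nrmM _ _))//.
by rewrite ler_pM ?nrm_ge0.
Qed.

(** Two consecutive iterates commute, hence
    [b'' - b' = (b' + b) * (b' - b) / 2], and the bounds satisfy the same
    identity. *)
Lemma visser_step h n : nrm h <= 1 ->
  nrm (visser h n.+1 - visser h n) <= visser_bound n.+1 - visser_bound n.
Proof.
move=> h1; elim: n => [|n IH].
  rewrite /= !subr0 !mulr0 !addr0 nrmZ normcR ger0_norm ?invr_ge0//.
  by rewrite ler_pM2l ?invr_gt0.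
set b' := visser h n.+1 in IH *; set b := visser h n in IH *.
have bb : b * b' = b' * b by rewrite visser_comm// -visser_comm.
have -> : visser h n.+2 - b' = half *: ((b' + b) * (b' - b)).
  rewrite [visser h n.+2]/= [in X in _ - X]/b' /= -scalerBr; congr (_ *: _).
  rewrite opprD addrACA subrr add0r -/b -/b' mulrBr !mulrDl bb.
  by rewrite opprD addrA addrK.
rewrite nrmZ normcR ger0_norm ?invr_ge0//.
have /(le_trans (nrmM _ _)) : nrm (b' + b) * nrm (b' - b) <=
    (visser_bound n.+1 + visser_bound n) * (visser_bound n.+1 - visser_bound n).
  rewrite ler_pM ?nrm_ge0// (le_trans (nrmD _ _))// lerD//; exact: visser_nrm.
have e1 : visser_bound n.+1 =
  2^-1 * (1 + visser_bound n * visser_bound n) by [].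
have e2 : visser_bound n.+2 =
  2^-1 * (1 + visser_bound n.+1 * visser_bound n.+1) by [].
by move: e1 e2; move: (visser_bound n.+2) (visser_bound n.+1) => v2 v1; lra.
Qed.

Lemma visser_dist h m n : nrm h <= 1 -> (m <= n)%N ->
  nrm (visser h m - visser h n) <= visser_bound n - visser_bound m.
Proof.
move=> h1 /subnK <-; elim: (n - m)%N => [|k IH]; first by rewrite !subrr nrm0.
rewrite addSn; set b' := visser h _.+1.
have -> : visser h m - b' =
    (visser h m - visser h (k + m)) + (visser h (k + m) - b').
  by rewrite addrA addrNK.
rewrite (le_trans (nrmD _ _))//.
by have := visser_step (k + m) h1; rewrite nrmB -/b'; lra.
Qed.

Lemma visser_limit h : nrm h <= 1 -> exists b : A, forall e : R, 0 < e ->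
  exists N, forall n, (N <= n)%N -> nrm (b - visser h n) < e.
Proof.
move=> h1; apply: nrm_complete => e e0.
have ub : has_ubound (range visser_bound).
  by exists 1 => _ [n _ <-]; have /andP[] := visser_bound_itv n.
have cv : cvgn visser_bound by apply: nondecreasing_is_cvgn visser_bound_le ub.
have le_lim := nondecreasing_cvgn_le visser_bound_le cv.
have /cvgrPdist_lt/(_ e e0)[N _ /(_ N (leqnn N)) /=] := cv.
rewrite ger0_norm ?subr_ge0// => NP; exists N => n Nn.
rewrite (le_lt_trans (visser_dist h1 Nn))// (le_lt_trans _ NP)//.
by rewrite lerB.
Qed.

(** The form in which limits are identified below: [x - y] is smaller than any
    multiple of a fixed constant. *)
Lemma eq_small x y K : (forall e : R, 0 < e -> nrm (x - y) <= K * e) -> x = y.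
Proof.
move=> le; apply/eqP; rewrite -subr_eq0; apply/eqP/nrm0_eq0.
have [->|y0] := eqVneq (nrm (x - y)) 0; first by [].
have yp : 0 < nrm (x - y) by rewrite lt_def y0 nrm_ge0.
have [K0|K0] := leP K 0; first by have := le 1 ltr01; lra.
have := le (nrm (x - y) / (2 * K)).
rewrite divr_gt0 ?mulr_gt0// => /(_ isT).
suff -> : K * (nrm (x - y) / (2 * K)) = nrm (x - y) / 2 by lra.
by field; rewrite gt_eqF.
Qed.

(** The root is [1 - b], with [b] the limit of the iteration. It commutes with
    whatever commutes with [h] because the iterates do, and [|b| <= 1] makes it
    possible to extract a further root, of [1 - b] itself. *)
Lemma cstar_sqrt h : star h = h -> nrm h <= 1 -> exists w,
  [/\ star w = w, w * w = 1 - h, nrm (1 - w) <= 1 &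
      forall x, x * h = h * x -> x * w = w * x].
Proof.
move=> hh h1; have [b bP] := visser_limit h1.
have close (e : R) : 0 < e -> exists n,
    nrm (b - visser h n) < e /\ nrm (b - visser h n.+1) < e.
  by move=> /bP[N NP]; exists N; split; exact: NP.
have vn1 n : nrm (visser h n) <= 1.
  by rewrite (le_trans (visser_nrm _ h1))//; have /andP[] := visser_bound_itv n.
have b1 : nrm b <= 1.
  apply/ler_addgt0Pr => e /close[n [bn _]].
  rewrite -[b](subrK (visser h n)) (le_trans (nrmD _ _))// addrC.
  by rewrite lerD// ltW.
have bstar : star b = b.
  apply: (@eq_small _ _ 2) => e /close[n [bn _]].
  have -> : star b - b = star (b - visser h n) - (b - visser h n).
    by rewrite starD starN visser_star// opprB addrA subrK.
  by rewrite (le_trans (nrmD _ _))// nrmN nrm_star; lra.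
have bcomm x : x * h = h * x -> x * b = b * x.
  move=> xh; apply: (@eq_small _ _ (2 * nrm x)) => e /close[n [bn _]].
  have -> : x * b - b * x = x * (b - visser h n) - (b - visser h n) * x.
    by rewrite mulrBr mulrBl visser_comm// opprB addrA subrK.
  rewrite (le_trans (nrmD _ _))// nrmN.
  have := nrmM x (b - visser h n); have := nrmM (b - visser h n) x.
  by have := nrm_ge0 x; nra.
have bfix : b + b = h + b * b.
  apply: (@eq_small _ _ 4) => e /close[n [bn bn1]].
  set c := visser h n in bn; set c' := visser h n.+1 in bn1.
  have cc : c' + c' = h + c * c.
    rewrite -(scale1r c') -scalerDl /c' /= scalerA -[1]/(1%:C%C).
    rewrite -rmorphD -rmorphM (_ : (1 + 1) * 2^-1 = 1 :> R) ?scale1r//.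
    by lra.
  have bc : b * c = c * b by apply/esym/bcomm; rewrite -visser_comm.
  have -> : b + b - (h + b * b) =
      ((b - c') + (b - c')) - (b + c) * (b - c).
    rewrite mulrBr !mulrDl bc (opprD (c * b)) (addrA _ (- (c * b))) addrK.
    by rewrite addrACA -opprD cc opprB !opprD !addrA subrK.
  have := nrmD (b - c' + (b - c')) (- ((b + c) * (b - c))).
  have := nrmD (b - c') (b - c'); rewrite nrmN.
  have := nrmM (b + c) (b - c); have := nrmD b c; have := vn1 n.
  rewrite -/c.
  by have := nrm_ge0 (b + c); have := nrm_ge0 (b - c); nra.
exists (1 - b); split.
- by rewrite starD starN star1 bstar.
- rewrite mulrBl mul1r mulrBr mulr1 -(addrA 1) -opprD addrA; congr (1 - _).
  by rewrite bfix addrK.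
- by rewrite opprB addrC subrK.
- by move=> x xh; rewrite mulrBl mulrBr mulr1 mul1r bcomm.
Qed.

End SquareRoots.

Section AbsoluteValue.
Variables (R : realType) (A : cstarAlgType R[i]).
Implicit Types (h x y z w a : A) (r : R).

(** [h] is the real part of [h + i w], and [h + i w] is [r] times a unitary. *)
Lemma nrm_real_part h w r : star h = h -> star w = w -> h * w = w * h ->
  0 <= r -> h * h + w * w = (r ^+ 2)%:C%C *: (1 : A) -> nrm h <= r.
Proof.
move=> hh ww hw r0 hwr; set U := h + 'i%C *: w.
have iE : ('i%C : R[i])^* = - 'i%C by rewrite complexiE conjCi.
have ii : ('i%C : R[i]) * 'i%C = -1 by rewrite -expr2 sqr_i.
have sU : star U = h - 'i%C *: w by rewrite starD starZ hh ww iE scaleNr.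
have UU : star U * U = (r ^+ 2)%:C%C *: (1 : A).
  rewrite sU mulrBl !mulrDr !scalemulAr !scalemulAl scalerA ii scaleN1r.
  by rewrite hw opprD opprK addrA addrK.
have Ur : nrm U <= r.
  rewrite -(@ler_pXn2r _ 2)// ?nnegrE ?nrm_ge0// -nrm_cstar UU nrmZ normcR.
  rewrite ger0_norm ?exprn_ge0//.
  by rewrite ler_piMr ?exprn_ge0// nrm1.
have := nrmD U (star U); rewrite nrm_star {1}sU {1}/U.
rewrite addrACA subrr addr0 -[h + h]mulr2n -scaler_nat nrmZ.
have -> : normc (2%:R : R[i]) = 2.
  by rewrite (_ : 2%:R = (2 : R)%:C%C) ?normcR ?ger0_norm// rmorph_nat.
by lra.
Qed.

Lemma conjR r : (r%:C%C : R[i])^* = r%:C%C.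
Proof. by apply/CrealP; rewrite complex_real. Qed.

Lemma scale2 (r1 r2 : R) x : r1%:C%C *: (r2%:C%C *: x) = (r1 * r2)%:C%C *: x.
Proof. by rewrite scalerA rmorphM. Qed.

Lemma star_scale1 r : star (r%:C%C *: (1 : A)) = r%:C%C *: (1 : A).
Proof. by rewrite starZr star1. Qed.

Lemma comm_scale (c : R[i]) x y : x * y = y * x -> x * (c *: y) = (c *: y) * x.
Proof. by rewrite scalemulAr scalemulAl => ->. Qed.

(** For a contraction [a], the square root of [1 - a^2] is a contraction too,
    so that [1 - a^2] is one, and [|a|] is the square root of [1 - (1 - a^2)].
    The element [m] is [|a|], and [w] is a square root of it, which witnesses
    its positivity. *)
Lemma cstar_abs a : star a = a -> exists m w,
  [/\ star m = m /\ star w = w, w * w = m, m * m = a * a,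
      forall x, x * a = a * x -> x * m = m * x &
      forall x, x * a = a * x -> x * w = w * x].
Proof.
move=> aa; wlog a1 : a aa / nrm a <= 1.
  move=> H; set r := nrm a + 1; have r0 : 0 < r by rewrite ltr_wpDl ?nrm_ge0.
  have a'1 : nrm (r^-1%:C%C *: a) <= 1.
    rewrite nrmZ normcR ger0_norm; last by rewrite invr_ge0 ltW.
    rewrite mulrC ler_pdivrMr// mul1r.
    by rewrite /r lerDl.
  have a'E : star (r^-1%:C%C *: a) = r^-1%:C%C *: a by rewrite starZr aa.
  have [m [w [[mm ww] wm ma cm cw]]] := H _ a'E a'1.
  exists (r%:C%C *: m), ((Num.sqrt r)%:C%C *: w); split.
  - by rewrite !starZr mm ww.
  - by rewrite scalemulAl scalemulAr scale2 wm -expr2 sqr_sqrtr// ltW.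
  - rewrite scalemulAl scalemulAr ma scalemulAl scalemulAr !scale2.
    by rewrite mulfK ?gt_eqF// mulfV ?gt_eqF// scale1r.
  - by move=> x xa; exact/comm_scale/cm/comm_scale.
  - by move=> x xa; exact/comm_scale/cw/comm_scale.
have sq_le1 x : nrm x <= 1 -> nrm (x * x) <= 1.
  by move=> x1; rewrite (le_trans (nrmM _ _))// mulr_ile1// nrm_ge0.
have sa : star (a * a) = a * a by rewrite starMr aa.
have [v [vv v2 _ cv]] := cstar_sqrt sa (sq_le1 _ a1).
have v1 : nrm v <= 1.
  apply: (@nrm_real_part v a) => //.
    by apply/esym/cv; rewrite mulrA.
  by rewrite v2 subrK expr1n scale1r.
have sk : star (1 - a * a) = 1 - a * a by rewrite starD starN star1 sa.
have k1 : nrm (1 - a * a) <= 1 by rewrite -v2 sq_le1.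
have [m [mm m2 m1 cm]] := cstar_sqrt sk k1.
have s1m : star (1 - m) = 1 - m by rewrite starD starN star1 mm.
have [w [ww w2 _ cw]] := cstar_sqrt s1m m1.
have cma x : x * a = a * x -> x * m = m * x.
  move=> xa; apply: cm; rewrite mulrBl mulrBr mulr1 mul1r; congr (_ - _).
  by rewrite mulrA xa -mulrA xa mulrA.
exists m, w; split => //.
- by rewrite w2 opprB addrC subrK.
- by rewrite m2 opprB addrC subrK.
- move=> x xa; apply: cw; rewrite mulrBl mulrBr mulr1 mul1r; congr (_ - _).
  exact: cma.
Qed.

End AbsoluteValue.

(** * Positive functionals *)

Section PositiveFunctional.
Variables (R : realType) (A : cstarAlgType R[i]) (phi : A -> R[i]).
Hypothesis phiD : {morph phi : x y / x + y}.
Hypothesis phiZ : forall (c : R[i]) x, phi (c *: x) = c * phi x.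
Hypothesis phi_star : forall x, phi (star x) = (phi x)^*.
Hypothesis phi_pos : forall x, 0 <= phi (star x * x).
Implicit Types (x y z : A) (r : R) (c : R[i]).

(** The Gelfand-Naimark-Segal seminorm of [phi], squared. The Hilbert space is
    never formed: its vectors are represented by the elements of [A]. *)
Definition sq x : R := complex.Re (phi (star x * x)).

Lemma sqE x : phi (star x * x) = (sq x)%:C%C.
Proof. by rewrite /sq RRe_real// ger0_real. Qed.

Lemma sq_ge0 x : 0 <= sq x.
Proof. by rewrite -ler0c -sqE. Qed.

Lemma phi0 : phi 0 = 0.
Proof. by rewrite -(scale0r (0 : A)) phiZ mul0r. Qed.

Lemma phiN x : phi (- x) = - phi x.
Proof. by rewrite -scaleN1r phiZ mulN1r. Qed.

Lemma phiB x y : phi (x - y) = phi x - phi y.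
Proof. by rewrite phiD phiN. Qed.

Lemma phi_conj x y : phi (star x * y) = (phi (star y * x))^*.
Proof. by rewrite -phi_star starMr starK. Qed.

Lemma sqD x y : sq (x + y) = sq x + sq y + 2 * complex.Re (phi (star y * x)).
Proof.
rewrite {1}/sq starD mulrDl !mulrDr !phiD (phi_conj x y) !sqE.
case: (phi (star y * x)) => p q /=; lra.
Qed.

Lemma sqZ c x : sq (c *: x) = normc c ^+ 2 * sq x.
Proof.
apply: complexI; rewrite -sqE starZ scalemulAl scalemulAr !phiZ sqE mulrA.
by rewrite rmorphM/= rmorphXn/= [_ * c]mulrC -normCK.
Qed.

(** The quadratic [t |-> sq (x - t z y)], with [z] the inner product of [x] and
    [y], is nonnegative. *)
Lemma cauchy_schwarz_sq x y : normc (phi (star y * x)) ^+ 2 <= sq x * sq y.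
Proof.
set z := phi _; set n : R := normc z ^+ 2.
have n0 : 0 <= n by rewrite sqr_ge0.
have pos (t : R) : 0 <= sq x - 2 * t * n + t ^+ 2 * n * sq y.
  have := sq_ge0 (x + ((- t)%:C%C * z) *: y).
  rewrite sqD sqZ starZ scalemulAl phiZ -/z rmorphM/= conjR -[_ * _ * z]mulrA.
  rewrite [z^* * z]mulrC -normCK normcM exprMn normcR real_normK ?num_real//.
  have -> : `|z| = (normc z)%:C%C by [].
  by rewrite -rmorphXn -rmorphM/= sqrrN -/n mulNr mulrN (mulrA 2) addrAC.
have [y0|y0] := eqVneq (sq y) 0.
  rewrite y0 mulr0 leNgt; apply/negP => np.
  (* Any [t] with [2 * t * n > sq x] contradicts [pos]. *)
  have := pos ((sq x + 1) / n); rewrite y0 mulr0 addr0 -mulrA divfK ?gt_eqF//.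
  by have := sq_ge0 x; lra.
have yp : 0 < sq y by rewrite lt_def y0 sq_ge0.
have := pos (sq y)^-1.
have -> : sq x - 2 * (sq y)^-1 * n + (sq y)^-1 ^+ 2 * n * sq y =
    sq x - n / sq y by field.
by rewrite subr_ge0 ler_pdivrMr.
Qed.

Definition nphi x : R := Num.sqrt (sq x).

Lemma nphi_ge0 x : 0 <= nphi x.
Proof. exact: sqrtr_ge0. Qed.

Lemma nphi_sq x : nphi x ^+ 2 = sq x.
Proof. by rewrite sqr_sqrtr ?sq_ge0. Qed.

Lemma cauchy_schwarz x y : normc (phi (star y * x)) <= nphi y * nphi x.
Proof.
rewrite -(@ler_pXn2r _ 2)// ?nnegrE ?mulr_ge0 ?nphi_ge0 ?normc_ge0//.
by rewrite exprMn !nphi_sq mulrC cauchy_schwarz_sq.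
Qed.

Lemma Re_le_normc (z : R[i]) : complex.Re z <= normc z.
Proof.
have := normc_ge_Re z; rewrite lecR; exact/le_trans/ler_norm.
Qed.

Lemma nphiD x y : nphi (x + y) <= nphi x + nphi y.
Proof.
rewrite -(@ler_pXn2r _ 2)// ?nnegrE ?addr_ge0 ?nphi_ge0//.
have := cauchy_schwarz x y; have := Re_le_normc (phi (star y * x)).
rewrite sqrrD !nphi_sq sqD -mulr_natl; lra.
Qed.

(** For a contraction [z], [1 - z^* z] is the square of a self-adjoint element,
    hence positive under [phi]. *)
Lemma nphi_mul z x : nphi (z * x) <= nrm z * nphi x.
Proof.
wlog z1 : z / nrm z = 1.
  move=> H; have [z0|z0] := eqVneq (nrm z) 0.
    rewrite (nrm0_eq0 z0) mul0r nrm0 mul0r /nphi /sq mulr0.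
    by rewrite phi0 sqrtr0.
  have zp : 0 < nrm z by rewrite lt_def z0 nrm_ge0.
  have := H ((nrm z)^-1%:C%C *: z).
  rewrite nrmZ normcR ger0_norm ?invr_ge0 ?nrm_ge0// mulVf// => /(_ erefl).
  rewrite scalemulAl /nphi sqZ normcR real_normK ?num_real// sqrtrM ?sqr_ge0//.
  by rewrite sqrtr_sqr ger0_norm ?invr_ge0 ?nrm_ge0// ler_pdivrMl// mul1r.
have sz : star (star z * z) = star z * z by rewrite starMr starK.
have z1' : nrm (star z * z) <= 1 by rewrite nrm_cstar z1 expr1n.
have [w [ww w2 _ _]] := cstar_sqrt sz z1'.
rewrite z1 mul1r ler_sqrt ?sq_ge0// -lecR -!sqE -subr_ge0 -phiB.
suff -> : star x * x - star (z * x) * (z * x) = star (w * x) * (w * x) by [].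
rewrite !starMr ww -!mulrA (mulrA w) w2 mulrBl mul1r mulrBr.
by rewrite !mulrA.
Qed.

Hypothesis phi1 : phi 1 = 1.

Lemma nphi_le_nrm x : nphi x <= nrm x.
Proof.
have n1 : nphi 1 = 1 by rewrite /nphi /sq star1 mulr1 phi1 sqrtr1.
by have := nphi_mul x 1; rewrite n1 !mulr1.
Qed.

Hypothesis phi_faithful : forall v : A, (forall y : A, sq (v * y) = 0) -> v = 0.

(** The operator norm of the representation on the seminormed space of [phi]
    bounds the norm of [A]: this is the fact that injective representations of
    C*-algebras are isometric. Let [p] be twice the positive part of [a = h^2 -
    r^2]. The form of [a] is nonpositive, while [p a p] is the positive element
    [(w p)^* (w p)]; faithfulness gives [w p = 0], hence [p = 0]. Thus [h^2 +
    |a| = r^2], where [|a|] is a square, and [h] is the real part of an element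
    of norm at most [r]. *)
Lemma nrm_le_bound_selfadjoint h r : star h = h -> 0 <= r ->
  (forall y, nphi (h * y) <= r * nphi y) -> nrm h <= r.
Proof.
move=> hh r0 hr.
have [a aE] : exists a, a = h * h - (r ^+ 2)%:C%C *: (1 : A) by eexists.
have aa : star a = a by rewrite aE starD starN starMr hh star_scale1.
have ha : h * a = a * h.
  by rewrite aE mulrBr mulrBl mulrA scalemulAr scalemulAl mulr1 mul1r.
have [m [w [[mm ww] wm ma cm cw]]] := cstar_abs aa.
have am : a * m = m * a by exact: cm.
have wa : w * a = a * w by apply/esym/cw.
have wm' : w * m = m * w by rewrite -wm mulrA.
have [p pE] : exists p, p = m + a by eexists.
have pp : star p = p by rewrite pE starD mm aa.
have pa : p * a = m * p by rewrite pE mulrDl mulrDr ma addrC.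
have wp : w * p = p * w by rewrite pE mulrDr mulrDl wm' wa.
have key : star (w * p) * (w * p) = star p * a * p.
  have pm : p * m = m * p by rewrite pE mulrDl mulrDr am.
  by rewrite starMr ww pp pa -(mulrA p w) (mulrA w w) wm mulrA pm.
have wp0 : w * p = 0.
  apply: phi_faithful => y; apply/eqP; rewrite eq_le sq_ge0 andbT.
  have -> : sq (w * p * y) = sq (h * (p * y)) - r ^+ 2 * sq (p * y).
    apply: complexI; rewrite rmorphB rmorphM/= -!sqE -phiZ -phiB; congr phi.
    rewrite starMr !mulrA -[star y * _ * w * p]mulrA -[star y * _ * _]mulrA key.
    rewrite !starMr hh aE mulrBr !mulrBl scalemulAr mulr1 scalemulAl.
    by rewrite mulrBr mulrBl scalemulAr scalemulAl !mulrA.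
  suff : sq (h * (p * y)) <= r ^+ 2 * sq (p * y) by lra.
  by rewrite -!nphi_sq -exprMn lerXn2r ?nnegrE ?mulr_ge0 ?nphi_ge0.
have p0 : p = 0.
  apply: nrm0_eq0; apply/eqP; rewrite -sqrf_eq0 -nrm_cstar pp.
  have mp : m * p = 0 by rewrite -wm -mulrA wp0 mulr0.
  have ap : a * p = m * p by rewrite pE !mulrDr am ma addrC.
  have -> : p * p = m * p + a * p by rewrite -mulrDl -pE.
  by rewrite ap mp addr0 nrm0.
have wr : h * h + w * w = (r ^+ 2)%:C%C *: (1 : A).
  rewrite wm; have -> : m = - a by apply/eqP; rewrite -addr_eq0 -pE p0.
  by rewrite aE opprB addrC subrK.
exact: nrm_real_part hh ww (cw _ ha) r0 wr.
Qed.

(** The general case follows from the self-adjoint element [z^* z], since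
    [|z^* z| = |z|^2]. *)
Lemma nrm_le_bound z r : 0 <= r ->
  (forall x y, normc (phi (star x * (z * y))) <= r * nphi x * nphi y) ->
  nrm z <= r.
Proof.
move=> r0 zr.
have zy y : nphi (z * y) <= r * nphi y.
  have [->|zy0] := eqVneq (nphi (z * y)) 0; first by rewrite mulr_ge0 ?nphi_ge0.
  have zyp : 0 < nphi (z * y) by rewrite lt_def zy0 nphi_ge0.
  rewrite -(ler_pM2l zyp) mulrCA mulrA.
  have := zr (z * y) y; rewrite sqE normcR ger0_norm ?sq_ge0// -nphi_sq.
  by rewrite expr2.
rewrite -(@ler_pXn2r _ 2)// ?nnegrE ?nrm_ge0// -nrm_cstar.
apply: nrm_le_bound_selfadjoint; rewrite ?exprn_ge0//.
  by rewrite starMr starK.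
move=> y.
have [->|v0] := eqVneq (nphi (star z * z * y)) 0.
  by rewrite mulr_ge0 ?exprn_ge0 ?nphi_ge0.
have vp : 0 < nphi (star z * z * y) by rewrite lt_def v0 nphi_ge0.
set v := star z * z * y in v0 vp *.
rewrite -(ler_pM2l vp) -expr2 nphi_sq.
have -> : sq v = normc (phi (star (z * v) * (z * y))).
  by rewrite starMr -mulrA (mulrA (star z)) -/v sqE normcR ger0_norm ?sq_ge0.
apply: (le_trans (cauchy_schwarz _ _)).
apply: (le_trans (ler_pM (nphi_ge0 _) (nphi_ge0 _) (zy v) (zy y))).
by rewrite mulrACA -expr2 mulrCA.
Qed.

End PositiveFunctional.

(** * Commutants, linear spans and generated C*-subalgebras *)

Section Subalgebras.
Variables (R : realType) (A : cstarAlgType R[i]).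
Implicit Types (S D : set A) (x y z : A) (c : R[i]).

Lemma cstar_generated_subalgebra S : cstar_subalgebra (cstar_generated S).
Proof.
split=> [|x y Dx Dy|c x Dx|x y Dx Dy|x Dx|].
- by move=> D [/csub0].
- by move=> D DP; have [/csubD + _] := DP; apply; [exact: Dx|exact: Dy].
- by move=> D DP; have [/csubZ + _] := DP; apply; exact: Dx.
- by move=> D DP; have [/csubM + _] := DP; apply; [exact: Dx|exact: Dy].
- by move=> D DP; have [/csub_star + _] := DP; apply; exact: Dx.
- by apply: closed_bigI => D [/csub_closed].
Qed.

Lemma sub_cstar_generated S : S `<=` cstar_generated S.
Proof. exact: sub_smallest. Qed.

Lemma cstar_generated_min S D : cstar_subalgebra D -> S `<=` D ->
  cstar_generated S `<=` D.
Proof. exact: smallest_sub. Qed.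

Definition commutant S : set A := [set x | forall y, S y -> x * y = y * x].

Lemma commutant_subalgebra S : (forall x, S x -> S (star x)) ->
  cstar_subalgebra (commutant S).
Proof.
move=> Sstar.
split=> [y _|x y Sx Sy z Sz|c x Sx y Sy|x y Sx Sy z Sz|x Sx y Sy|].
- by rewrite mul0r mulr0.
- by rewrite mulrDl mulrDr Sx ?Sy.
- by rewrite scalemulAl scalemulAr Sx.
- by rewrite -mulrA Sy// mulrA Sx// mulrA.
- by rewrite -[y]starK -!starMr Sx//; exact: Sstar.
- apply/closed_nrmP => x Sx y Sy.
  apply: (@eq_small _ _ _ _ (2 * nrm y)) => e /Sx[z Sz xz].
  have -> : x * y - y * x = (x - z) * y - y * (x - z).
    by rewrite mulrBr mulrBl (Sz _ Sy) opprB addrA subrK.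
  rewrite (le_trans (nrmD _ _))// nrmN.
  have := nrmM y (x - z); have := nrmM (x - z) y; have := nrm_ge0 y; nra.
Qed.

(** The commutant of the generators is a C*-subalgebra containing the
    generators, hence all of the generated algebra; the same argument applied
    to the commutant of that algebra gives the claim. *)
Lemma cstar_generated_commute S : (forall x, S x -> S (star x)) ->
  (forall x y, S x -> S y -> x * y = y * x) ->
  forall x y, cstar_generated S x -> cstar_generated S y -> x * y = y * x.
Proof.
move=> Sstar Scomm; set D := cstar_generated S.
have DS : D `<=` commutant S.
  apply: cstar_generated_min; first exact: commutant_subalgebra.
  by move=> x Sx y; exact: Scomm.
have Dstar x : D x -> D (star x).
  exact: (csub_star (cstar_generated_subalgebra S)).
suff DD : D `<=` commutant D by move=> x y Dx; exact: DD.
apply: cstar_generated_min; first exact: commutant_subalgebra.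
by move=> x Sx y /DS ->.
Qed.

(** Linear spans as an inductive predicate, so that statements about spans are
    proved by induction on the number of summands. *)
Inductive lspan S : A -> Prop :=
| lspan0 : lspan S 0
| lspanS c x y : S x -> lspan S y -> lspan S (c *: x + y).

Lemma lspan_sub S x : S x -> lspan S x.
Proof.
by move=> Sx; rewrite -[x]addr0 -[x]scale1r; apply: lspanS => //; exact: lspan0.
Qed.

Lemma lspanD S x y : lspan S x -> lspan S y -> lspan S (x + y).
Proof.
elim=> [|c s z Ss _ IH] Sy; first by rewrite add0r.
by rewrite -addrA; apply: lspanS => //; exact: IH.
Qed.

Lemma lspanZ S c x : lspan S x -> lspan S (c *: x).
Proof.
elim=> [|d s z Ss _ IH]; first by rewrite scaler0; exact: lspan0.
by rewrite scalerDr scalerA; exact: lspanS.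
Qed.

Lemma lspanM S : (forall x y, S x -> S y -> lspan S (x * y)) ->
  forall x y, lspan S x -> lspan S y -> lspan S (x * y).
Proof.
move=> SM x y; elim=> [|c s z Ss _ IH] Sy.
  by rewrite mul0r; exact: lspan0.
rewrite mulrDl scalemulAl; apply: lspanD (IH Sy); apply: lspanZ.
elim: Sy => [|d t w St _ IHt]; first by rewrite mulr0; exact: lspan0.
by rewrite mulrDr scalemulAr; apply: lspanD IHt; apply: lspanZ; exact: SM.
Qed.

Lemma lspan_star S : (forall x, S x -> lspan S (star x)) ->
  forall x, lspan S x -> lspan S (star x).
Proof.
move=> Sstar x; elim=> [|c s z Ss _ IH]; first by rewrite star0; exact: lspan0.
by rewrite starD starZ; apply: lspanD IH; apply: lspanZ; exact: Sstar.
Qed.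

Definition approximable D : set A :=
  [set x | forall e : R, 0 < e -> exists2 y, D y & nrm (x - y) < e].

Lemma approximable_closed D : closed (approximable D).
Proof.
apply/closed_nrmP => x xD e e0; have e2 : 0 < e / 2 by rewrite divr_gt0.
have [y yD xy] := xD _ e2; have [z Dz yz] := yD _ e2; exists z => //.
rewrite -[x](subrK y) -addrA (le_lt_trans (nrmD _ _))//.
by rewrite [ltRHS](splitr e) ltrD.
Qed.

Lemma sub_approximable D : D `<=` approximable D.
Proof. by move=> x Dx e e0; exists x => //; rewrite subrr nrm0. Qed.

(** The products are treated one factor at a time, which reduces the general
    case to that of a left factor in the span. *)
Lemma approximable_lspan_subalgebra S :
  (forall x y, S x -> S y -> lspan S (x * y)) ->
  (forall x, S x -> lspan S (star x)) ->
  cstar_subalgebra (approximable (lspan S)).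
Proof.
move=> SM Sstar.
have idem x :
    approximable (approximable (lspan S)) x -> approximable (lspan S) x.
  exact: (closed_nrmP _).1 (@approximable_closed _) x.
have small (e : R) x : 0 < e -> exists d, [/\ 0 < d & d * nrm x < e].
  move=> e0; exists (e / (nrm x + 1)).
  have p : 0 < nrm x + 1 by rewrite ltr_wpDl ?nrm_ge0.
  split; first by rewrite divr_gt0.
  by rewrite mulrAC ltr_pdivrMr// ltr_pM2l// ltrDl.
have mull s y : lspan S s -> approximable (lspan S) y ->
    approximable (lspan S) (s * y).
  move=> Ss Sy e e0; have [d [d0 de]] := small e s e0.
  have [t St yt] := Sy _ d0; exists (s * t); first exact: lspanM.
  rewrite -mulrBr (le_lt_trans (nrmM _ _))// (le_lt_trans _ de)// mulrC.
  by rewrite ler_wpM2r ?nrm_ge0// ltW.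
split=> [|x y Sx Sy e e0|c x Sx|x y Sx Sy|x Sx e e0|].
- by apply: sub_approximable; exact: lspan0.
- have e2 : 0 < e / 2 by rewrite divr_gt0.
  have [x' Sx' xx] := Sx _ e2; have [y' Sy' yy] := Sy _ e2.
  exists (x' + y'); first exact: lspanD.
  rewrite opprD addrACA (le_lt_trans (nrmD _ _))//.
  by rewrite [ltRHS](splitr e) ltrD.
- have -> : c *: x = (c *: (1 : A)) * x by rewrite scalemulAl mul1r.
  move=> e e0; have [d [d0 de]] := small e (c *: (1 : A)) e0.
  have [t St yt] := Sx _ d0; exists (c *: t); first exact: lspanZ.
  have -> : c *: t = (c *: (1 : A)) * t by rewrite scalemulAl mul1r.
  rewrite -mulrBr (le_lt_trans (nrmM _ _))// (le_lt_trans _ de)// mulrC.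
  by rewrite ler_wpM2r ?nrm_ge0// ltW.
- apply: idem => e e0; have [d [d0 de]] := small e y e0.
  have [t St yt] := Sx _ d0; exists (t * y); first exact: mull.
  rewrite -mulrBl (le_lt_trans (nrmM _ _))// (le_lt_trans _ de)//.
  by rewrite ler_wpM2r ?nrm_ge0// ltW.
- have [t St yt] := Sx _ e0; exists (star t); first exact: lspan_star.
  by rewrite -starN -starD nrm_star.
- exact: approximable_closed.
Qed.

End Subalgebras.

(** * The vector state of the vector at the identity *)

Section Ell2Inner.
Variables (R : realType) (G : choiceType).
Implicit Types (x y : ell2 R G) (k : G).

Lemma sum_single (f : G -> R[i]^o) k :
  (forall h, h != k -> f h = 0) -> summability.sum f = f k.
Proof.
move=> f0; apply: lim_near_cst;
  [exact: norm_hausdorff|exact: summability.totally_filter|].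
exists (fset1 k) => //= B kB.
have {}kB : k \in B by apply: (fsubsetP kB); rewrite inE.
rewrite /summability.partial_sum (bigD1 (FSetSub kB))//= big1 ?addr0//.
move=> h hk; apply: f0; apply: contra_neq hk => hk; exact: val_inj.
Qed.

Lemma ell2_inner_xi x k : ell2_inner x (xi R k) = x k.
Proof.
rewrite /ell2_inner (@sum_single _ k) => [|h hk] /=; rewrite /delta_fun.
  by rewrite eqxx conjC1 mulr1.
by rewrite (negPf hk) conjC0 mulr0.
Qed.

Lemma ell2_inner_xil x k : ell2_inner (xi R k) x = (x k)^*.
Proof.
rewrite /ell2_inner (@sum_single _ k) => [|h hk] /=; rewrite /delta_fun.
  by rewrite eqxx mul1r.
by rewrite (negPf hk) mul0r.
Qed.

Lemma ell2_inner0 x : ell2_inner x 0 = 0.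
Proof.
rewrite /ell2_inner /summability.sum; apply: (@lim_near_cst R[i]^o);
  [exact: norm_hausdorff|exact: summability.totally_filter|].
exists fset0 => //= B _; rewrite /summability.partial_sum big1// => h _.
by rewrite [X in X ^*](_ : _ = 0) ?conjC0 ?mulr0.
Qed.

(** A divergent filter has the default limit [0], so that no convergence has to
    be established. *)
Lemma limit_ge0 (F : set_system R[i]^o) : ProperFilter F ->
  F [set z : R[i] | 0 <= z] -> 0 <= lim F.
Proof.
move=> FF Fpos; have [cF|dF] := pselect (cvg F); last by rewrite dvgP.
set l := lim F.
have near_l e : 0 < e -> exists2 w : R[i], 0 <= w & normc (l - w) < e.
  move=> e0; have /fcvgrPdist_lt/(_ e%:C%C) := cF; rewrite ltcR => /(_ e0) Fe.
  have [w [w0 lw]] := filter_ex (filterI Fpos Fe).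
  by exists w => //; rewrite -ltcR.
have Re_le (z : R[i]) : `|complex.Re z| <= normc z.
  by case: z => p q /=; rewrite -sqrtr_sqr ler_wsqrtr// lerDl sqr_ge0.
have Im_le (z : R[i]) : `|complex.Im z| <= normc z.
  by case: z => p q /=; rewrite -sqrtr_sqr ler_wsqrtr// lerDr sqr_ge0.
rewrite lecE /=; apply/andP; split.
  rewrite -normr_le0 leNgt; apply/negP => /near_l[w].
  rewrite lecE /= => /andP[/eqP w0 _]; apply/negP; rewrite -leNgt.
  by have := Im_le (l - w); rewrite raddfB/= w0 subr0.
rewrite leNgt -oppr_gt0; apply/negP => /near_l[w].
rewrite lecE /= => /andP[_ w0]; apply/negP; rewrite -leNgt.
apply: le_trans (Re_le _); rewrite raddfB/= -normrN opprB.
by rewrite (le_trans _ (ler_norm _))// lerDr.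
Qed.

Lemma ell2_inner_ge0 x : 0 <= ell2_inner x x.
Proof.
apply: limit_ge0; first exact: fmap_proper_filter (summability.totally_filter).
exists fset0 => //= B _.
by apply: sumr_ge0 => h _; rewrite mul_conjC_ge0.
Qed.

End Ell2Inner.

Section VectorState.
Variables (R : realType) (G : groupType) (A : cstarAlgType R[i]).
Variable rho : A -> ell2 R G -> ell2 R G.
Hypothesis rhoP : ell2_representation rho.

(** The coordinate at [1] of [rho a xi_1] is the inner product
    [<rho a xi_1, xi_1>]. *)
Definition vector_state (a : A) : R[i] := rho a (xi R 1%g) 1%g.

Lemma rep0 x : rho 0 x = 0.
Proof.
have := rep_linear rhoP 1 0 0 x; rewrite !scale1r addr0.
by move=> /esym/eqP; rewrite -subr_eq0 addrK => /eqP.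
Qed.

Lemma rep_vect0 a : rho a 0 = 0.
Proof.
have [lin _] := rep_bounded rhoP a.
have := lin 1 0 0; rewrite !scale1r addr0.
by move=> /esym/eqP; rewrite -subr_eq0 addrK => /eqP.
Qed.

Lemma vector_stateD : {morph vector_state : a b / a + b}.
Proof.
move=> a b; rewrite /vector_state -[a]scale1r (rep_linear rhoP) !scale1r.
by [].
Qed.

Lemma vector_stateZ (c : R[i]) a : vector_state (c *: a) = c * vector_state a.
Proof.
by rewrite /vector_state -[c *: a]addr0 (rep_linear rhoP) rep0 addr0.
Qed.

Lemma vector_state_star a : vector_state (star a) = (vector_state a)^*.
Proof.
rewrite /vector_state -ell2_inner_xi (rep_star rhoP) starK.
exact: ell2_inner_xil.
Qed.

Lemma vector_state_ge0 a : 0 <= vector_state (star a * a).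
Proof.
rewrite /vector_state -ell2_inner_xi (rep_mul rhoP) (rep_star rhoP) starK.
exact: ell2_inner_ge0.
Qed.

Lemma vector_state1 : vector_state 1 = 1.
Proof. by rewrite /vector_state (rep_one rhoP) /= /delta_fun eqxx. Qed.

Lemma rho_coordinate a k x :
  rho a x k = ell2_inner x (rho (star a) (xi R k)).
Proof. by rewrite -ell2_inner_xi (rep_star rhoP). Qed.

(** The coordinates of [rho a^* xi_k] are conjugate to those of the [rho a
    xi_h], so that [rho a^*] vanishes on the basis; hence so do all coordinates
    [<rho a x, xi_k> = <x, rho a^* xi_k>]. *)
Lemma rho_basis_eq0 a :
  (forall h k, rho a (xi R h) k = 0) -> forall x, rho a x = 0.
Proof.
move=> a0 x; apply: val_inj; apply/funext => k /=.
rewrite rho_coordinate (_ : rho _ _ = 0) ?ell2_inner0//.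
apply: val_inj; apply/funext => h /=.
rewrite rho_coordinate starK (_ : rho _ _ = 0) ?ell2_inner0//.
by apply: val_inj; apply/funext => l /=; rewrite a0.
Qed.

End VectorState.

(** * Spanning monomials of the boundary quotient *)

Section Monomials.
Variables (R : realType) (G : groupType) (P : monoidType).
Variables (theta : P -> G -> G) (A : cstarAlgType R[i]).
Variables (u : G -> A) (s : P -> A).
Hypothesis ads : algebraic_dynamical_system theta.
Hypothesis rel : bq_relations theta u s.
Implicit Types (g h k : G) (p q r : P).

Lemma theta1 p : theta p 1%g = 1%g.
Proof. by apply: (mulgI (theta p 1%g)); rewrite -(ads_morph ads) !mulg1. Qed.

Lemma thetaV p g : theta p g^-1%g = (theta p g)^-1%g.
Proof.
by apply: (mulgI (theta p g)); rewrite -(ads_morph ads) !mulgV theta1.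
Qed.

Lemma star_u g : star (u g) = u g^-1%g.
Proof.
rewrite -[RHS]mul1r -(proj1 (bq_uV rel g)) -mulrA -(bq_uM rel) mulgV.
by rewrite (bq_u1 rel) mulr1.
Qed.

Lemma u_sstar p g : u g * star (s p) = star (s p) * u (theta p g).
Proof.
rewrite -[u g]starK -starMr star_u (bq_I rel) starMr star_u thetaV.
by rewrite invgK.
Qed.

Definition monomial g p q h : A := u g * s p * star (s q) * u h.

Definition monomials : set A :=
  [set x | exists g p q h, x = monomial g p q h].

(** Relation (II) rewrites the inner factor [s_q^* u_g s_p'], after which (I)
    and its adjoint move the group elements to the two ends. *)
Lemma monomialM g p q h g' p' q' h' :
  lspan monomials (monomial g p q h * monomial g' p' q' h').
Proof.
rewrite /monomial; set X := star (s q) * u (h * g')%g * s p'.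
have -> : u g * s p * star (s q) * u h * (u g' * s p' * star (s q') * u h') =
    u g * s p * X * (star (s q') * u h').
  by rewrite /X (bq_uM rel) !mulrA.
have [[g1 [g2 [r [t f]]]]|nf] := pselect (exists g1 g2 r t,
    bq_factorization theta q p' (h * g')%g g1 g2 r t); last first.
  by rewrite /X (bq_II0 rel nf) mulr0 mul0r; exact: lspan0.
rewrite /X (bq_II rel f); apply: lspan_sub.
exists (g * theta p g1)%g, (p * r)%g, (q' * t)%g, (theta q' g2 * h')%g.
rewrite /monomial !(bq_uM rel) !(bq_sM rel) starMr.
rewrite -!mulrA; congr (_ * _); rewrite !mulrA -(bq_I rel) -!mulrA.
by do 4 congr (_ * _); rewrite !mulrA u_sstar.
Qed.

Lemma monomial_star g p q h :
  star (monomial g p q h) = monomial h^-1%g q p g^-1%g.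
Proof. by rewrite /monomial !starMr starK !star_u !mulrA. Qed.

Lemma monomials_dense : cstar_generated (range u `|` range s) = [set: A] ->
  forall x, approximable (lspan monomials) x.
Proof.
move=> gen x; suff : [set: A] `<=` approximable (lspan monomials) by apply.
rewrite -gen; apply: cstar_generated_min.
  apply: approximable_lspan_subalgebra.
    move=> _ _ [g [p [q [h ->]]]] [g' [p' [q' [h' ->]]]]; exact: monomialM.
  move=> _ [g [p [q [h ->]]]]; rewrite monomial_star; apply: lspan_sub.
  by exists h^-1%g, q, p, g^-1%g.
move=> _ [[g _ <-]|[p _ <-]]; apply/sub_approximable/lspan_sub.
  exists g, 1%g, 1%g, 1%g.
  by rewrite /monomial (bq_s1 rel) star1 (bq_u1 rel) !mulr1.
exists 1%g, p, 1%g, 1%g.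
by rewrite /monomial (bq_s1 rel) star1 (bq_u1 rel) !mulr1 mul1r.
Qed.

Lemma u_generated_commute : (forall g h, (g * h = h * g)%g) ->
  forall x y, cstar_generated (range u) x -> cstar_generated (range u) y ->
  x * y = y * x.
Proof.
move=> Gab.
apply: cstar_generated_commute => [_ [g _ <-]|_ _ [g _ <-] [h _ <-]].
  by exists g^-1%g => //; rewrite star_u.
by rewrite -!(bq_uM rel) Gab.
Qed.

Lemma nrm_u g : nrm (u g) <= 1.
Proof.
have := nrm_cstar (u g); rewrite (proj1 (bq_uV rel g)) => h.
have := nrm1 A; have := nrm_ge0 (u g); rewrite h; nra.
Qed.

End Monomials.

(** * Averages over conjugation by group elements *)

Section Averages.
Variables (R : realType) (G : groupType) (P : monoidType).
Variables (theta : P -> G -> G) (A : cstarAlgType R[i]).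
Variables (u : G -> A) (s : P -> A).
Hypothesis ads : algebraic_dynamical_system theta.
Hypothesis rel : bq_relations theta u s.
Hypothesis G_abelian : forall g h : G, (g * h = h * g)%g.
Implicit Types (g h k : G) (p q r : P) (x y : A) (l : seq G).

Definition average l x : A :=
  ((size l)%:R^-1 : R)%:C%C *: \sum_(g <- l) (u g * x * star (u g)).

Lemma average_is_linear l (c : R[i]) x y :
  average l (c *: x + y) = c *: average l x + average l y.
Proof.
rewrite /average scalerA mulrC -scalerA -scalerDr; congr (_ *: _).
rewrite scaler_sumr -big_split; apply: eq_bigr => g _ /=.
by rewrite mulrDr mulrDl scalemulAr scalemulAl.
Qed.

Lemma averageB l x y : average l (x - y) = average l x - average l y.
Proof.
by rewrite addrC -scaleN1r average_is_linear scaleN1r addrC.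
Qed.

Lemma average0 l : average l 0 = 0.
Proof. by rewrite -[0 in LHS](subrr 0) averageB subrr. Qed.

(** Composites of averages are averages, and they commute with each other since
    [G] is abelian: several averages, each adapted to one monomial, may be
    performed in any order. *)
Lemma average_allpairs l1 l2 x :
  average [seq (g * h)%g | g <- l1, h <- l2] x = average l1 (average l2 x).
Proof.
rewrite /average size_allpairs natrM invfM.
rewrite rmorphM -scalerA; congr (_ *: _).
rewrite big_allpairs_dep scaler_sumr; apply: eq_bigr => g _.
rewrite scalemulAr scalemulAl mulr_sumr mulr_suml; congr (_ *: _).
apply: eq_bigr => h _.
by rewrite (bq_uM rel) starMr !mulrA.
Qed.

Lemma averageC l1 l2 x : average l1 (average l2 x) = average l2 (average l1 x).
Proof.
rewrite -!average_allpairs /average !size_allpairs mulnC; congr (_ *: _).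
rewrite !big_allpairs_dep exchange_big /=; apply: eq_bigr => h _.
by apply: eq_bigr => g _; rewrite G_abelian.
Qed.

Lemma average_commutant l x : l != [::] -> (forall g, x * u g = u g * x) ->
  average l x = x.
Proof.
move=> l0 xu; rewrite /average (eq_bigr (fun=> x)) => [|g _].
  have sz : (size l)%:R != 0 :> R by rewrite pnatr_eq0 size_eq0.
  rewrite big_const_seq count_predT iter_addr_0 -[x *+ _]scaler_nat.
  rewrite -[X in _ *: (X *: _)](rmorph_nat (real_complex R)) scalerA -rmorphM/=.
  by rewrite mulVf// scale1r.
by rewrite -xu -mulrA (proj2 (bq_uV rel g)) mulr1.
Qed.

(** Stated for an arbitrary seminorm [N], because it is applied both to the
    norm and to the modulus of a matrix coefficient. *)
Lemma average_bound (N : A -> R) l x (e : R) : l != [::] ->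
  N 0 <= 0 -> (forall y z, N (y + z) <= N y + N z) ->
  (forall (r : R) y, 0 <= r -> N (r%:C%C *: y) = r * N y) ->
  (forall g, N (u g * x * star (u g)) <= e) -> N (average l x) <= e.
Proof.
move=> l0 N0 ND NZ Ne; have sp : (0 : R) < (size l)%:R.
  by rewrite ltr0n lt0n size_eq0.
rewrite /average NZ; last by rewrite invr_ge0 ltW.
rewrite ler_pdivrMl//.
elim: (l) => [|g l' IH]; first by rewrite big_nil mul0r.
by rewrite big_cons /= -add1n natrD mulrDl mul1r (le_trans (ND _ _))// lerD.
Qed.

Lemma nrm_average l x : l != [::] -> nrm (average l x) <= nrm x.
Proof.
move=> l0; apply: average_bound => //; first by rewrite nrm0.
- exact: nrmD.
- by move=> r y r0; rewrite nrmZ normcR ger0_norm.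
move=> g; have u1 := nrm_u rel g; rewrite (le_trans (nrmM _ _))// nrm_star.
rewrite (le_trans (ler_pM (nrm_ge0 _) (nrm_ge0 _) (nrmM _ _) (lexx _)))//.
by rewrite mulrAC ler_piMl ?nrm_ge0// mulr_ile1 ?nrm_ge0.
Qed.

End Averages.

(** * Matrix coefficients of the canonical representation *)

Section Coefficients.
Variables (R : realType) (G : groupType) (P : monoidType).
Variables (theta : P -> G -> G) (A : cstarAlgType R[i]).
Variables (u : G -> A) (s : P -> A) (rho : A -> ell2 R G -> ell2 R G).
Hypothesis ads : algebraic_dynamical_system theta.
Hypothesis rel : bq_relations theta u s.
Hypothesis can : canonical_representation theta u s rho.
Implicit Types (g h k : G) (p q r : P) (x y : A) (l : seq G).

Let rhoP := proj1 can.
Local Notation phi := (vector_state rho).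
Local Notation sqphi := (sq phi).
Local Notation nphiphi := (nphi phi).

Let phiD := vector_stateD rhoP.
Let phiZ := vector_stateZ rhoP.
Let phi_star := vector_state_star rhoP.
Let phi_pos := vector_state_ge0 rhoP.
Let phi1 := vector_state1 rhoP.

Lemma rho_u g h : rho (u g) (xi R h) = xi R (g * h)%g.
Proof.
rewrite -[u g]mulr1 -(bq_s1 rel) (proj2 can).
by rewrite (ads_id ads).
Qed.

Lemma rho_s p h : rho (s p) (xi R h) = xi R (theta p h).
Proof. by rewrite -[s p]mul1r -(bq_u1 rel) (proj2 can) mul1g. Qed.

(** [s_p] maps basis vectors injectively to basis vectors, so that its adjoint
    is a partial inverse. *)
Lemma rho_sstar p h : rho (star (s p)) (xi R h) = 0 \/
  exists k, rho (star (s p)) (xi R h) = xi R k.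
Proof.
have co k : rho (star (s p)) (xi R h) k = (theta p k == h)%:R.
  by rewrite rho_coordinate// starK rho_s ell2_inner_xi /= /delta_fun.
have [[k hk]|nk] := pselect (exists k, theta p k = h); [right|left].
  exists k; apply: val_inj; apply/funext => k' /=.
  by rewrite co -hk /delta_fun (inj_eq (@ads_inj _ _ _ ads p)).
apply: val_inj; apply/funext => k /=; rewrite co.
by case: eqP => // hk; case: nk; exists k.
Qed.

Lemma phi_coefficient k x h : phi (star (u k) * x * u h) = rho x (xi R h) k.
Proof.
rewrite /vector_state -ell2_inner_xi !(rep_mul rhoP) (rep_star rhoP) starK.
by rewrite !rho_u !mulg1 ell2_inner_xi.
Qed.

(** The coefficients of [v] at basis vectors are inner products of [v u_h] with
    [u_k] for [phi], hence vanish by the Cauchy-Schwarz inequality. *)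
Lemma phi_faithful (rho_inj : injective rho) (v : A) :
  (forall y : A, sqphi (v * y) = 0) -> v = 0.
Proof.
move=> v0; apply: rho_inj; apply/funext => x; rewrite (rep0 rhoP).
apply: (rho_basis_eq0 rhoP) => h k; rewrite -phi_coefficient -mulrA.
have := cauchy_schwarz phiD phiZ phi_star phi_pos (v * u h) (u k).
have -> : nphiphi (v * u h) = 0 by rewrite /nphi v0 sqrtr0.
rewrite mulr0.
move=> le0; apply: eq0_normc; apply/eqP; rewrite eq_le le0 /=.
exact: normc_ge0.
Qed.

(** A spanning monomial maps [xi_1] to a basis vector or to [0]. *)
Lemma lspan_monomials_xi1 y : lspan (monomials u s) y ->
  exists2 b, lspan (range u) b & rho y (xi R 1%g) = rho b (xi R 1%g).
Proof.
elim=> [|c _ z [g [p [q [h ->]]]] _ [b Sb zb]].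
  by exists 0 => //; exact: lspan0.
have [d Sd yd] : exists2 d, lspan (range u) d &
    rho (monomial u s g p q h) (xi R 1%g) = rho d (xi R 1%g).
  rewrite /monomial !(rep_mul rhoP) rho_u mulg1.
  have [->|[k ->]] := rho_sstar q h.
    exists 0; first exact: lspan0.
    by rewrite !(rep_vect0 rhoP) (rep0 rhoP).
  exists (u (g * theta p k)%g); first exact/lspan_sub/imageT.
  by rewrite rho_s !rho_u mulg1.
exists (c *: d + b); last by rewrite !(rep_linear rhoP) yd zb.
by apply: lspanD Sb; exact: lspanZ.
Qed.

(** The group elements are cyclic for [phi]: it suffices to consider spanning
    monomials, and on [xi_1] these agree with elements of the group algebra. *)
Lemma lspan_u_dense (dense : forall x, approximable (lspan (monomials u s)) x) x
  (e : R) : 0 < e -> exists2 b, lspan (range u) b & nphiphi (x - b) < e.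
Proof.
move=> /(dense x)[y Sy xy]; have [b Sb yb] := lspan_monomials_xi1 Sy.
exists b => //; have n0 : nphiphi (y - b) = 0.
  rewrite /nphi /sq /vector_state (rep_mul rhoP).
  have -> : rho (y - b) (xi R 1%g) = 0.
    by rewrite addrC -scaleN1r (rep_linear rhoP) yb scaleN1r addNr.
  by rewrite (rep_vect0 rhoP) sqrtr0.
rewrite -[x](subrK y) -addrA.
apply: le_lt_trans (nphiD phiD phiZ phi_star phi_pos _ _) _.
rewrite n0 addr0; apply: le_lt_trans xy.
exact: (nphi_le_nrm phiD phiZ phi_pos phi1).
Qed.

End Coefficients.

(** * Averages of monomials and the commutant of the group *)

Section MaximalAbelian.
Variables (R : realType) (G : groupType) (P : monoidType).
Variables (theta : P -> G -> G) (A : cstarAlgType R[i]).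
Variables (u : G -> A) (s : P -> A) (rho : A -> ell2 R G -> ell2 R G).
Hypothesis ads : algebraic_dynamical_system theta.
Hypothesis rel : bq_relations theta u s.
Hypothesis can : canonical_representation theta u s rho.
Hypothesis G_abelian : forall g h : G, (g * h = h * g)%g.
Implicit Types (g h k : G) (p q r : P) (x y : A) (l : seq G) (e : R).

Let rhoP := proj1 can.
Local Notation phi := (vector_state rho).
Local Notation nphiphi := (nphi phi).

Let phiD := vector_stateD rhoP.
Let phiZ := vector_stateZ rhoP.
Let phi_star := vector_state_star rhoP.
Let phi_pos := vector_state_ge0 rhoP.
Let phi1 := vector_state1 rhoP.
Let phi_0 := phi0 phiZ.

(** The supremum of the moduli of the matrix coefficients is a norm weaker than
    that of [A]. The averages of an off-diagonal monomial tend to [0] in this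
    sense, although in general not in norm. *)
Definition coef_bound x e : Prop :=
  forall k k', normc (phi (star (u k) * x * u k')) <= e.

Lemma coef_boundD x y d e :
  coef_bound x d -> coef_bound y e -> coef_bound (x + y) (d + e).
Proof.
move=> xd ye k k'; rewrite mulrDr mulrDl phiD.
by rewrite (le_trans (le_normcD _ _))// lerD.
Qed.

Lemma coef_boundZ (c : R[i]) x e :
  coef_bound x e -> coef_bound (c *: x) (normc c * e).
Proof.
move=> xe k k'; rewrite scalemulAr scalemulAl phiZ normcM.
by rewrite ler_wpM2l ?normc_ge0.
Qed.

Lemma coef_bound_average l x e : l != [::] -> coef_bound x e ->
  coef_bound (average u l x) e.
Proof.
move=> l0 xe k k'.
pose N z : R := normc (phi (star (u k) * z * u k')).
apply: (@average_bound _ _ _ u N) => //; rewrite /N.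
- by rewrite mulr0 mul0r phi_0 normc0.
- by move=> y z; rewrite mulrDr mulrDl phiD le_normcD.
- move=> r y r0; rewrite scalemulAr scalemulAl phiZ normcM normcR ger0_norm//.
move=> g; have := xe (g^-1 * k)%g (g^-1 * k')%g.
rewrite !(bq_uM rel) starMr !(star_u rel) invgK !mulrA.
by rewrite -!mulrA.
Qed.

Definition averages_to x c : Prop := forall e, 0 < e ->
  exists2 l, l != [::] & coef_bound (average u l x - c) e.

(** The averages adapted to the two terms are composed; each leaves the limit
    of the other term fixed. *)
Lemma averages_to_lincomb (a : R[i]) x y c d :
  (forall g, c * u g = u g * c) -> (forall g, d * u g = u g * d) ->
  averages_to x c -> averages_to y d -> averages_to (a *: x + y) (a *: c + d).
Proof.
move=> cu du xc yd e e0.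
have a1 : 0 < normc a + 1 by rewrite ltr_wpDl ?normc_ge0.
have d0 : 0 < e / 2 / (normc a + 1) by rewrite !divr_gt0.
have [l1 l10 b1] := xc _ d0.
have [l2 l20 b2] := yd (e / 2) (divr_gt0 e0 (ltr0Sn _ 1)).
exists [seq (g * h)%g | g <- l1, h <- l2].
  by rewrite -size_eq0 size_allpairs muln_eq0 !size_eq0 negb_or l10.
rewrite (average_allpairs rel) !average_is_linear.
rewrite (averageC rel G_abelian l1 l2 x).
have -> : a *: average u l2 (average u l1 x) + average u l1 (average u l2 y) -
    (a *: c + d) = a *: average u l2 (average u l1 x - c) +
    average u l1 (average u l2 y - d).
  rewrite !averageB (average_commutant rel l20 cu).
  rewrite (average_commutant rel l10 du).
  by rewrite scalerBr opprD addrACA.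
move=> k k'.
apply: (@le_trans _ _ (normc a * (e / 2 / (normc a + 1)) + e / 2)).
  by apply: coef_boundD; [apply: coef_boundZ|]; exact: coef_bound_average.
rewrite [leRHS](splitr e) lerD2r mulrCA ler_piMr//.
  by rewrite divr_ge0// ltW.
by rewrite ler_pdivrMr// mul1r lerDl.
Qed.

(** The average over representatives of the cosets of [theta_p(G)] is exact: by
    (III) the translates of the projection [s_p s_p^*] sum to [1]. *)
Lemma averages_to_diagonal p g h : finite_index theta p ->
  exists c : R[i], averages_to (monomial u s g p p h) (c *: u (g * h)%g).
Proof.
move=> fin; set l := [seq xget 1%g K | K <- fset_set (left_cosets theta p)].
have sum1 : \sum_(k <- l) (u k * s p * star (s p) * star (u k)) = 1.
  by rewrite big_map -[RHS](bq_sum rel fin) fsbig_finite.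
have l0 : l != [::].
  apply/eqP => l0; have := phi1; rewrite -sum1 l0 big_nil.
  rewrite phi_0 => /esym/eqP.
  by rewrite oner_eq0.
exists ((size l)%:R^-1 : R)%:C%C => // e e0; exists l => // k k'.
suff -> : average u l (monomial u s g p p h) =
    ((size l)%:R^-1 : R)%:C%C *: u (g * h)%g.
  by rewrite subrr mulr0 mul0r phi_0 normc0 ltW.
rewrite /average; congr (_ *: _); rewrite (bq_uM rel) -[u g]mulr1 -sum1.
rewrite mulr_sumr mulr_suml; apply: eq_bigr => j _.
rewrite /monomial !mulrA !(star_u rel) -!(bq_uM rel) G_abelian -!mulrA.
by rewrite -!(bq_uM rel) (G_abelian h).
Qed.

Lemma sum_at_most_one (f : nat -> G) k N : injective f ->
  normc (\sum_(j <- iota 0 N) (k == f j)%:R : R[i]) <= 1.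
Proof.
move=> finj; have [[j /andP[jN /eqP jk]]|nj] :=
    pselect (exists j, (j \in iota 0 N) && (k == f j)).
  rewrite (bigD1_seq j)//= ?iota_uniq// {1}jk eqxx big1 ?addr0 ?normc1//.
  by move=> i ij; rewrite jk (inj_eq finj) eq_sym (negPf ij).
rewrite big_seq big1 ?normc0// => i iN; case: eqP => // fik.
by case: nj; exists i; rewrite iN fik eqxx.
Qed.

Lemma monomial_conj p q g h b :
  u (theta q b) * monomial u s g p q h * star (u (theta q b)) =
  monomial u s (g * Phi theta p q b^-1)%g p q h.
Proof.
rewrite /monomial (star_u rel) -(thetaV ads) !mulrA.
rewrite -[_ * u h * u _]mulrA -(bq_uM rel h) (G_abelian h) (bq_uM rel) !mulrA.
rewrite -[_ * star (s q) * u _]mulrA -(u_sstar ads rel) !mulrA.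
rewrite -[_ * s p * u _]mulrA (bq_I rel) !mulrA -!(bq_uM rel).
do 3 congr (_ * _); congr u; rewrite /Phi invgK.
by rewrite (G_abelian _ g) -mulgA (G_abelian (theta q b)).
Qed.

(** The average is taken over the elements [theta_q(a^j)] with [j < N]. By
    [monomial_conj] the conjugates are the monomials with left factors [g * Phi
    a^-j], which are pairwise distinct; hence at most one of them has a nonzero
    coefficient at a given position, and the average is bounded by [1 / N]. *)
Lemma averages_to_offdiagonal p q g h (a : G) : infinite_order a ->
  {in cyclic_subgroup a &, injective (Phi theta p q)} ->
  averages_to (monomial u s g p q h) 0.
Proof.
move=> a_inf Phi_inj e e0.
pose f j : G := Phi theta p q (a ^- j)%g.
have finj : injective f.
  move=> i j fij.
  have cyc n : (a ^- n)%g \in cyclic_subgroup a.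
    by apply/mem_set; exists n; right.
  have /invg_inj aij := Phi_inj _ _ (cyc i) (cyc j) fij.
  wlog ij : i j fij aij / (i <= j)%N.
    by move=> H; case/orP: (leq_total i j) => ij; [|symmetry]; exact: H.
  apply/eqP; rewrite eqn_leq ij leqNgt; apply/negP => ltij.
  apply: (a_inf (j - i)%N); first by rewrite subn_gt0.
  by apply: (mulgI (a ^+ i)%g); rewrite -expgnDr subnKC// mulg1.
pose N := (Num.truncn e^-1).+1.
have eN : e^-1 < N%:R by exact: truncnS_gt.
exists [seq theta q (a ^+ j)%g | j <- iota 0 N]; first by [].
move=> k k'; rewrite subr0 /average size_map size_iota big_map.
have conj j : u (theta q (a ^+ j)) * monomial u s g p q h *
    star (u (theta q (a ^+ j))) = monomial u s (g * f j)%g p q h.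
  exact: monomial_conj.
rewrite (eq_bigr _ (fun j _ => conj j)).
rewrite scalemulAr scalemulAl phiZ normcM normcR.
rewrite ger0_norm ?invr_ge0//.
have Ne : N%:R^-1 <= e.
  by rewrite -[e]invrK lef_pV2 ?posrE ?invr_gt0 ?ltr0n// ltW.
rewrite (le_trans _ Ne)// ler_piMr ?invr_ge0// (phi_coefficient ads rel can).
have sumE :
    rho (\sum_(j <- iota 0 N) monomial u s (g * f j)%g p q h) (xi R k') k =
    \sum_(j <- iota 0 N) rho (monomial u s (g * f j)%g p q h) (xi R k') k.
  elim: (iota 0 N) => [|j t IH]; first by rewrite !big_nil (rep0 rhoP).
  rewrite !big_cons -[X in rho (X + _)]scale1r (rep_linear rhoP) scale1r -IH.
  by [].
rewrite sumE.
have [r0|[m rm]] := rho_sstar ads rel can q (h * k')%g.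
  rewrite big1 ?normc0// => j _.
  rewrite /monomial !(rep_mul rhoP) (rho_u ads rel can) r0.
  by rewrite !(rep_vect0 rhoP).
rewrite (eq_bigr (fun j => (k == (g * f j * theta p m)%g)%:R)) => [|j _].
  by apply: sum_at_most_one => i j /mulIg/mulgI; exact: finj.
rewrite /monomial !(rep_mul rhoP) (rho_u ads rel can) rm.
by rewrite (rho_s rel can) (rho_u ads rel can).
Qed.

Hypothesis theta_index : forall p, finite_index theta p.
Hypothesis Phi_injective : forall p q, p <> q ->
  exists2 g, infinite_order g &
    {in cyclic_subgroup g &, injective (Phi theta p q)}.

Lemma u_commute_generated c g :
  cstar_generated (range u) c -> c * u g = u g * c.
Proof.
move=> Dc; apply: (u_generated_commute rel G_abelian Dc).
by apply: sub_cstar_generated; exact: imageT.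
Qed.

(** Every element of the dense subalgebra is averaged into [C^*(G)]: diagonal
    monomials go to multiples of group elements, the others to [0]. *)
Lemma lspan_averages_to y : lspan (monomials u s) y ->
  exists2 c, cstar_generated (range u) c & averages_to y c.
Proof.
have DP := cstar_generated_subalgebra (range u).
elim=> [|a _ z [g [p [q [h ->]]]] _ [d Dd zd]].
  exists 0; first exact: csub0 DP.
  move=> e e0; exists [:: 1%g] => // k k'.
  by rewrite average0 subr0 mulr0 mul0r phi_0 normc0 ltW.
have [c Dc mc] : exists2 c, cstar_generated (range u) c &
    averages_to (monomial u s g p q h) c.
  have [<-|/Phi_injective[b b_inf b_inj]] := pselect (p = q).
    have [c mc] := averages_to_diagonal g h (theta_index p).
    exists (c *: u (g * h)%g) => //; apply: (csubZ DP).
    by apply: sub_cstar_generated; exact: imageT.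
  by exists 0; [exact: csub0 DP|exact: averages_to_offdiagonal b_inf b_inj].
exists (a *: c + d); first by apply: (csubD DP) => //; exact: (csubZ DP).
by apply: averages_to_lincomb => // k; exact: u_commute_generated.
Qed.

(** [M] is the product of the [l^1]-norms of the coefficients of [b] and [b'].
    *)
Lemma coef_bound_group_algebra b b' : lspan (range u) b -> lspan (range u) b' ->
  exists2 M : R, 0 <= M & forall z e, coef_bound z e ->
    normc (phi (star b * (z * b'))) <= M * e.
Proof.
move=> Sb Sb'.
have left k : exists2 M : R, 0 <= M & forall z e, coef_bound z e ->
    normc (phi (star (u k) * (z * b'))) <= M * e.
  elim: Sb' => [|c _ y [k' _ <-] _ [M M0 MP]].
    exists 0 => // z e _; rewrite mul0r !mulr0 phi_0.
    by rewrite normc0.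
  exists (normc c + M) => [|z e ze]; first by rewrite addr_ge0 ?normc_ge0.
  rewrite !mulrDr phiD !scalemulAr phiZ (le_trans (le_normcD _ _))// mulrDl.
  by rewrite lerD ?MP// normcM ler_wpM2l ?normc_ge0// mulrA.
elim: Sb => [|c _ y [k _ <-] _ [M M0 MP]].
  exists 0 => // z e _; rewrite star0 !mul0r phi_0.
  by rewrite normc0.
have [N N0 NP] := left k.
exists (normc c * N + M) => [|z e ze].
  by rewrite addr_ge0 ?mulr_ge0 ?normc_ge0.
rewrite starD starZ !mulrDl phiD !scalemulAl phiZ (le_trans (le_normcD _ _))//.
rewrite lerD ?MP// normcM -mulrA.
by rewrite normc_conj ler_wpM2l ?normc_ge0// NP.
Qed.

Hypothesis dense : forall x, approximable (lspan (monomials u s)) x.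

(** Density of the group algebra for the seminorm of [phi]. *)
Lemma phi_bound_extend w (K : R) : 0 <= K ->
  (forall b, lspan (range u) b -> normc (phi (star b * w)) <= K * nphiphi b) ->
  forall v, normc (phi (star v * w)) <= K * nphiphi v.
Proof.
move=> K0 Kb v; apply/ler_addgt0Pr => /= e e0.
have p : 0 < nphiphi w + K + 1.
  by rewrite ltr_wpDl// addr_ge0// nphi_ge0.
have [b Sb vb] := lspan_u_dense ads rel can dense v (divr_gt0 e0 p).
set d := e / _ in vb.
have d0 : 0 < d by rewrite divr_gt0.
have dE : d * (nphiphi w + K + 1) = e by rewrite divfK ?gt_eqF.
have -> : star v * w = star (v - b) * w + star b * w.
  by rewrite -mulrDl -starD subrK.
rewrite phiD (le_trans (le_normcD _ _))//.
have h1 := cauchy_schwarz phiD phiZ phi_star phi_pos w (v - b).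
have h2 := Kb _ Sb.
have h3 : nphiphi b <= nphiphi v + nphiphi (v - b).
  have -> : nphiphi (v - b) = nphiphi (b - v).
    have := sqZ phiZ phi_pos (-1 : R[i]) (v - b).
    rewrite scaleN1r opprB normcN normc1 expr1n mul1r => h.
    by rewrite /nphi -h.
  by have := nphiD phiD phiZ phi_star phi_pos v (b - v); rewrite addrC subrK.
have h4 : nphiphi (v - b) * nphiphi w <= d * nphiphi w.
  by rewrite ler_wpM2r ?nphi_ge0// ltW.
have h5 : K * nphiphi b <= K * (nphiphi v + d).
  by rewrite ler_wpM2l// (le_trans h3)// lerD2l ltW.
apply: (le_trans (lerD (le_trans h1 h4) (le_trans h2 h5))).
by rewrite -dE; lra.
Qed.

Hypothesis rho_inj : injective rho.

(** Let [y] be a monomial combination with [|x - y| < e / 2] and [c] the limit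
    of its averages. Averages fix [x] and are contractive, so that [x - c] is
    the sum of an average of [x - y], of norm less than [e / 2], and of a term
    whose matrix coefficients are arbitrarily small. Testing against vectors of
    the group algebra the second term disappears, and the first bounds the norm
    of [x - c]. *)
Lemma commutant_u_generated x : (forall g, x * u g = u g * x) ->
  cstar_generated (range u) x.
Proof.
move=> xu; have DP := cstar_generated_subalgebra (range u).
have /closed_nrmP := csub_closed DP; apply => e e0.
have e2 : 0 < e / 2 by rewrite divr_gt0.
have [y Sy xy] := dense x e2.
have [c Dc yc] := lspan_averages_to Sy; exists c => //.
apply: (@le_lt_trans _ _ (e / 2)); last by lra.
have faithful := phi_faithful ads rel can rho_inj.
apply: (nrm_le_bound phiD phiZ phi_star phi_pos faithful (ltW e2)).
have core b b' : lspan (range u) b -> lspan (range u) b' ->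
    normc (phi (star b * ((x - c) * b'))) <= e / 2 * nphiphi b * nphiphi b'.
  move=> Sb Sb'; have [M M0 MP] := coef_bound_group_algebra Sb Sb'.
  apply/ler_addgt0Pr => d d0.
  have [l l0 lb] := yc _ (divr_gt0 d0 (ltr_wpDl M0 ltr01)).
  have -> : x - c = average u l (x - y) + (average u l y - c).
    by rewrite averageB (average_commutant rel l0 xu) addrA subrK.
  rewrite mulrDl mulrDr phiD (le_trans (le_normcD _ _))//.
  apply: lerD.
    apply: le_trans (cauchy_schwarz phiD phiZ phi_star phi_pos _ _) _.
    rewrite mulrAC [leRHS]mulrC ler_wpM2l ?nphi_ge0//.
    apply: le_trans (nphi_mul phiD phiZ phi_pos _ _) _.
    rewrite ler_wpM2r ?nphi_ge0// (le_trans (nrm_average rel _ l0))// ltW//.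
  apply: (le_trans (MP _ _ lb)).
  rewrite mulrCA ler_piMr//; first exact: ltW.
  rewrite ler_pdivrMr ?mul1r ?lerDl//.
  by rewrite ltr_wpDl.
move=> v w.
have half0 z : 0 <= e / 2 * nphiphi z by rewrite mulr_ge0 ?nphi_ge0// ltW.
have step b' : lspan (range u) b' -> forall v',
    normc (phi (star v' * ((x - c) * b'))) <= e / 2 * nphiphi b' * nphiphi v'.
  move=> Sb'; apply: phi_bound_extend => // b Sb.
  by rewrite mulrAC core.
rewrite (phi_conj phi_star) normc_conj starMr -[_ * _ * v]mulrA.
apply: phi_bound_extend => // b Sb.
rewrite (phi_conj phi_star) normc_conj starMr starK.
rewrite -[_ * _ * b]mulrA [leRHS]mulrAC.
exact: step.
Qed.

Lemma u_generated_maximal_abelian : maximal_abelian (cstar_generated (range u)).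
Proof.
have DP := cstar_generated_subalgebra (range u).
split; first by split => //; exact: (u_generated_commute rel G_abelian).
move=> E [EP Eab] DE; apply/seteqP; split => // x Ex.
apply: commutant_u_generated => g; apply: Eab => //.
by apply: DE; apply: sub_cstar_generated; exact: imageT.
Qed.

End MaximalAbelian.

Theorem theorem3p5 (R : realType) (G : groupType) (P : monoidType)
    (theta : P -> G -> G) (Q : cstarAlgType R[i]) (u : G -> Q) (s : P -> Q)
    (rho : Q -> ell2 R G -> ell2 R G)
    (ads : algebraic_dynamical_system theta)
    (G_abelian : forall g h : G, (g * h = h * g)%g)
    (P_directed : directed P)
    (theta_index : forall p : P, finite_index theta p)
    (Q_quotient : boundary_quotient theta u s)
    (rho_canonical : canonical_representation theta u s rho)
    (rho_faithful : injective rho)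
    (Phi_injective : forall p q : P, p <> q ->
      exists2 g : G, infinite_order g &
        {in cyclic_subgroup g &, injective (Phi theta p q)})
    (theta_minimal : minimal theta) :
  maximal_abelian (cstar_generated (range u)).
Proof.
have rel := bq_rel Q_quotient.
apply: (u_generated_maximal_abelian ads rel rho_canonical G_abelian) => //.
by apply: (monomials_dense ads rel); exact: bq_generated Q_quotient.
Qed.
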